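(* Let $(G_n)$ be a sequence of weighted graphs with uniformly bounded edgeweights (i.e. $\sup_n\max_{i,j}|\beta_{ij}(G_n)|<\infty$). Then $(G_n)$ is left-convergent if and only if it is a Cauchy sequence in the metric $\delta_\square$.
   Context: A weighted graph $G$ is a finite graph with nonempty node set $V(G)$, a weight $\alpha_i=\alpha_i(G)>0$ for each node $i$, and a real weight $\beta_{ij}=\beta_{ij}(G)=\beta_{ji}(G)$ for each edge $ij$ (loops $i=j$ are allowed); one sets $\beta_{ij}=0$ if $ij$ is not an edge. Put $\alpha_G=\sum_i\alpha_i(G)$. A simple graph is a finite graph without loops or multiple edges. Homomorphism densities: for a simple graph $F$ on $k$ nodes and a weighted graph $G$, $$t(F,G)=\frac{1}{\alpha_G^{k}}\sum_{\phi:V(F)\to V(G)}\ \prod_{i\in V(F)}\alpha_{\phi(i)}(G)\prod_{ij\in E(F)}\beta_{\phi(i)\phi(j)}(G),$$ the sum running over all maps. A sequence $(G_n)$ of weighted graphs with uniformly bounded edgeweights is left-convergent if $t(F,G_n)$ converges for every simple graph $F$. Cut distance: for $S,T\subseteq V(G)$ let $e_G(S,T)=\sum_{i\in S,\,j\in T}\alpha_i\alpha_j\beta_{ij}$. If $G,G'$ are weighted graphs on the same node set $V$ with the same nodeweights, $d_\square(G,G')=\max_{S,T\subseteq V}\frac{1}{\alpha_G^2}|e_G(S,T)-e_{G'}(S,T)|$. If $G$ and $G'$ have $n$ and $n'$ nodes and $\alpha_G=\alpha_{G'}=1$, a fractional overlay of $G$ and $G'$ is a nonnegative $n\times n'$ matrix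 $X$ with $\sum_u X_{iu}=\alpha_i(G)$ for all $i$ and $\sum_i X_{iu}=\alpha_u(G')$ for all $u$; $G[X]$ and $G'[X^\top]$ are the weighted graphs on $[n]\times[n']$ in which node $(i,u)$ has weight $X_{iu}$ and the edge $((i,u),(j,v))$ has weight $\beta_{ij}(G)$ in $G[X]$ and $\beta_{uv}(G')$ in $G'[X^\top]$ (here zero nodeweights are harmless). Then $\delta_\square(G,G')=\min_X d_\square(G[X],G'[X^\top])$ over all fractional overlays $X$. For general total nodeweights, first divide all nodeweights of $G$ by $\alpha_G$ and those of $G'$ by $\alpha_{G'}$. ($\delta_\square$ is a pseudometric, called a metric informally.) *)

(* Defs.v *)
From HB Require Import structures.
From mathcomp Require Import all_boot all_order all_algebra.
From mathcomp Require Import all_classical all_reals all_analysis.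

Set Implicit Arguments.
Unset Strict Implicit.
Unset Printing Implicit Defensive.

Import Order.TTheory GRing.Theory Num.Theory.
Import numFieldNormedType.Exports.

Local Open Scope classical_set_scope.
Local Open Scope ring_scope.

Record wgraph (R : realType) := WGraph {
  node : finType;
  wedge : rel node;
  nodew : node -> R;
  edgew : node -> node -> R;
  node_gt0 : (0 < #|node|)%N;
  wedge_sym : symmetric wedge;
  nodew_gt0 : forall i, 0 < nodew i;
  edgew_sym : forall i j, edgew i j = edgew j i;
  edgew_nonedge : forall i j, ~~ wedge i j -> edgew i j = 0
}.

Record sgraph := SGraph {
  num_vert : nat;
  adj : rel 'I_num_vert;
  adj_sym : symmetric adj;
  adj_irr : irreflexive adj
}.

Definition total_nodew (R : realType) (G : wgraph R) : R :=
  \sum_(i : node G) nodew i.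

(* Each edge of F contributes once: it is listed as the pair (i, j) with
   i < j. *)
Definition hom_density (R : realType) (F : sgraph) (G : wgraph R) : R :=
  (total_nodew G ^+ num_vert F)^-1 *
  \sum_(phi : {ffun 'I_(num_vert F) -> node G})
    (\prod_(i < num_vert F) nodew (phi i)) *
    \prod_(e : 'I_(num_vert F) * 'I_(num_vert F) | (e.1 < e.2)%N && adj e.1 e.2)
      edgew (phi e.1) (phi e.2).

Definition bounded_edgew (R : realType) (G : nat -> wgraph R) : Prop :=
  exists C : R, forall (n : nat) (i j : node (G n)), `|edgew i j| <= C.

Definition left_convergent (R : realType) (G : nat -> wgraph R) : Prop :=
  forall F : sgraph, cvg (hom_density F (G n) @[n --> \oo]).

(* The cut distance on a common node set is stated on bare weight functions,
   because the overlaid graphs G[X] may have zero nodeweights and so need not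
   be of type wgraph. *)
Definition cut_weight (R : realType) (V : finType) (a : V -> R)
    (b : V -> V -> R) (S T : {set V}) : R :=
  \sum_(i in S) \sum_(j in T) a i * a j * b i j.

Definition cut_dist (R : realType) (V : finType) (a : V -> R)
    (b b' : V -> V -> R) : R :=
  \big[Num.max/0]_(S : {set V}) \big[Num.max/0]_(T : {set V})
    (`|cut_weight a b S T - cut_weight a b' S T| / (\sum_i a i) ^+ 2).

Definition normalized_nodew (R : realType) (G : wgraph R) (i : node G) : R :=
  nodew i / total_nodew G.

Definition fractional_overlay (R : realType) (G G' : wgraph R)
    (X : node G -> node G' -> R) : Prop :=
  [/\ forall i u, 0 <= X i u,
      forall i, \sum_u X i u = normalized_nodew i &
      forall u, \sum_i X i u = normalized_nodew u].

(* d_square (G[X], G'[X^T]) on the node set node G * node G'. *)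
Definition overlay_dist (R : realType) (G G' : wgraph R)
    (X : node G -> node G' -> R) : R :=
  cut_dist (fun p : node G * node G' => X p.1 p.2)
    (fun p q => edgew p.1 q.1) (fun p q => edgew p.2 q.2).

(* The infimum is a minimum: overlay_dist is continuous in X on the overlays,
   which form a nonempty compact set. *)
Definition delta_cut (R : realType) (G G' : wgraph R) : R :=
  inf [set overlay_dist X | X in @fractional_overlay R G G'].

Definition cut_cauchy (R : realType) (G : nat -> wgraph R) : Prop :=
  forall eps : R, 0 < eps -> exists N : nat,
    forall m n : nat, (N <= m)%N -> (N <= n)%N -> delta_cut (G m) (G n) < eps.

(* Main.v *)
Require Import Defs.
From mathcomp Require Import all_boot all_order all_algebra.
From mathcomp Require Import all_classical all_reals all_analysis.
From mathcomp Require Import ring lra.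

(* From delta_cut to densities: two graphs with a common overlay can be pulled back to
   one node set, and t(F, .) changes by O(cut norm) when one edge kernel at a time is
   exchanged.

   From densities to delta_cut: let C bound the edgeweights.  Draw nodes X_1, ..., X_n of
   G independently with law alpha / alpha_G and give each pair i < j an edgeweight C or
   -C, independently given X and with mean beta(X_i, X_j).  The resulting random graph
   takes finitely many values, and the probability of each value is a fixed linear
   combination of homomorphism densities of G; so along a left-convergent sequence the
   laws of these random graphs form a Cauchy sequence.  By the triangle inequality it
   remains to see that the random graph is close to G in expectation, uniformly in G.
   Weak regularity gives a step kernel W, bounded by C, that is close to beta in cut norm.
   The cut norm is controlled by four-cycle densities; the expected four-cycle density of
   the sampled difference is, up to the O(1/n) quadruples with a repetition, the
   four-cycle density of beta - W, hence small.  Finally W and its sample are step kernels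
   with the same values and, by a variance bound, almost the same block weights, so they
   have an overlay with small mismatch. *)

Set Implicit Arguments.
Unset Strict Implicit.
Unset Printing Implicit Defensive.

Import Order.TTheory GRing.Theory Num.Theory.
Import numFieldNormedType.Exports.

Local Open Scope ring_scope.

(** * Cut norm of weighted kernels *)

Section CutForm.
Context {R : realType}.
Implicit Types (V P : finType) (c d : R).

Definition cut_form V (a : V -> R) (U : V -> V -> R) (f g : V -> R) : R :=
  \sum_x \sum_y a x * f x * (a y * g y) * U x y.

Definition unit_fun V (f : V -> R) := forall x, 0 <= f x <= 1.

(** Testing with [0,1]-valued functions instead of sets costs nothing, by [cut_le_sets], and
    survives averaging over fibres, on which [cut_le_pull] relies. *)
Definition cut_le V (a : V -> R) (U : V -> V -> R) c : Prop :=
  forall f g, unit_fun f -> unit_fun g -> `|cut_form a U f g| <= c.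

Lemma unit_fun0 V : unit_fun (fun _ : V => 0).
Proof. by move=> x; rewrite lexx ler01. Qed.

Lemma cut_form0 V a U : cut_form a U (fun _ : V => 0) (fun _ => 0) = 0.
Proof. by apply: big1 => x _; apply: big1 => y _; rewrite mulr0 mul0r mul0r. Qed.

Lemma cut_le_ge0 V (a : V -> R) U c : cut_le a U c -> 0 <= c.
Proof.
by move=> /(_ _ _ (@unit_fun0 V) (@unit_fun0 V)); rewrite cut_form0 normr0.
Qed.

Lemma cut_formD V (a : V -> R) U W f g :
  cut_form a (fun x y => U x y + W x y) f g = cut_form a U f g + cut_form a W f g.
Proof.
rewrite /cut_form -big_split; apply: eq_bigr => x _ /=.
by rewrite -big_split; apply: eq_bigr => y _ /=; rewrite mulrDr.
Qed.

Lemma cut_formN V (a : V -> R) U f g :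
  cut_form a (fun x y => - U x y) f g = - cut_form a U f g.
Proof.
rewrite /cut_form -sumrN; apply: eq_bigr => x _ /=.
by rewrite -sumrN; apply: eq_bigr => y _ /=; rewrite mulrN.
Qed.

Lemma cut_formBl V (a : V -> R) U f1 f2 g :
  cut_form a U (fun x => f1 x - f2 x) g = cut_form a U f1 g - cut_form a U f2 g.
Proof.
rewrite /cut_form -sumrB; apply: eq_bigr => x _ /=.
by rewrite -sumrB; apply: eq_bigr => y _ /=; ring.
Qed.

Lemma cut_formBr V (a : V -> R) U f g1 g2 :
  cut_form a U f (fun x => g1 x - g2 x) = cut_form a U f g1 - cut_form a U f g2.
Proof.
rewrite /cut_form -sumrB; apply: eq_bigr => x _ /=.
by rewrite -sumrB; apply: eq_bigr => y _ /=; ring.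
Qed.

Lemma cut_formZ V (a : V -> R) U f g c d :
  cut_form a U (fun x => c * f x) (fun x => d * g x) = c * d * cut_form a U f g.
Proof.
rewrite /cut_form mulr_sumr; apply: eq_bigr => x _ /=.
by rewrite mulr_sumr; apply: eq_bigr => y _ /=; ring.
Qed.

Lemma eq_cut_form V (a a' : V -> R) U U' f f' g g' :
  a =1 a' -> U =2 U' -> f =1 f' -> g =1 g' ->
  cut_form a U f g = cut_form a' U' f' g'.
Proof.
move=> ea eU ef eg; apply: eq_bigr => x _; apply: eq_bigr => y _.
by rewrite !ea eU ef eg.
Qed.

Lemma eq_cut_le V (a a' : V -> R) U U' c :
  a =1 a' -> U =2 U' -> cut_le a U c -> cut_le a' U' c.
Proof.
move=> ea eU h f g hf hg.
by rewrite -(eq_cut_form ea eU (frefl f) (frefl g)); apply: h.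
Qed.

Lemma cut_le_trans V (a : V -> R) U c d : c <= d -> cut_le a U c -> cut_le a U d.
Proof. by move=> cd h f g hf hg; apply: le_trans cd; apply: h. Qed.

Lemma cut_leD V (a : V -> R) U W c d :
  cut_le a U c -> cut_le a W d -> cut_le a (fun x y => U x y + W x y) (c + d).
Proof.
move=> hU hW f g hf hg; rewrite cut_formD.
by apply: le_trans (ler_normD _ _) _; apply: lerD; [apply: hU|apply: hW].
Qed.

Lemma cut_leN V (a : V -> R) U c : cut_le a U c -> cut_le a (fun x y => - U x y) c.
Proof. by move=> hU f g hf hg; rewrite cut_formN normrN; apply: hU. Qed.

Lemma cut_leB V (a : V -> R) U W c d :
  cut_le a U c -> cut_le a W d -> cut_le a (fun x y => U x y - W x y) (c + d).
Proof. by move=> hU hW; apply: cut_leD => //; apply: cut_leN. Qed.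

Lemma cut_le_abs V (a : V -> R) U : (forall x, 0 <= a x) ->
  cut_le a U (\sum_x \sum_y a x * a y * `|U x y|).
Proof.
move=> a0 f g hf hg; apply: le_trans (ler_norm_sum _ _ _) _; apply: ler_sum => x _.
apply: le_trans (ler_norm_sum _ _ _) _; apply: ler_sum => y _.
rewrite normrM ler_wpM2r// normrM !normrM.
have /andP[f0 f1] := hf x; have /andP[g0 g1] := hg y.
rewrite !ger0_norm//; apply: ler_pM; rewrite ?mulr_ge0//.
  by rewrite ler_piMr.
by rewrite ler_piMr.
Qed.

Lemma sum_prod_meas V (a : V -> R) : \sum_x a x = 1 ->
  \sum_x \sum_y a x * a y = 1.
Proof.
move=> a1; rewrite -[RHS]a1; apply: eq_bigr => x _.
by rewrite -mulr_sumr a1 mulr1.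
Qed.

Lemma cut_le_sup V (a : V -> R) U c : (forall x, 0 <= a x) -> \sum_x a x = 1 ->
  (forall x y, `|U x y| <= c) -> cut_le a U c.
Proof.
move=> a0 a1 hU; apply: cut_le_trans (cut_le_abs U a0).
rewrite -[leRHS]mul1r -(sum_prod_meas a1) mulr_suml; apply: ler_sum => x _.
rewrite mulr_suml; apply: ler_sum => y _.
by apply: ler_wpM2l => //; apply: mulr_ge0.
Qed.

Lemma pos_part_unit V (f : V -> R) : (forall x, `|f x| <= 1) ->
  unit_fun (fun x => Num.max (f x) 0).
Proof.
by move=> hf x; rewrite le_max lexx orbT ge_max ler01 andbT (le_trans (ler_norm _)).
Qed.

Lemma pos_partB (x : R) : x = Num.max x 0 - Num.max (- x) 0.
Proof.
rewrite /Num.max oppr_lt0; case: ltgtP => [||->]; lra.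
Qed.

(* Splitting f and g into positive and negative parts costs the factor 4. *)
Lemma cut_le_signed V (a : V -> R) U c f g : cut_le a U c ->
  (forall x, `|f x| <= 1) -> (forall x, `|g x| <= 1) ->
  `|cut_form a U f g| <= 4 * c.
Proof.
move=> hU hf hg.
pose p (h : V -> R) x := Num.max (h x) 0; pose n (h : V -> R) x := Num.max (- h x) 0.
have up h : (forall x, `|h x| <= 1) -> unit_fun (p h) by apply: pos_part_unit.
have un h : (forall x, `|h x| <= 1) -> unit_fun (n h).
  by move=> hh; apply: (@pos_part_unit _ (fun x => - h x)) => x; rewrite normrN.
have e h : h =1 (fun x => p h x - n h x) by move=> x; apply: pos_partB.
rewrite (eq_cut_form (frefl a) (fun x => frefl (U x)) (e f) (e g)).
rewrite cut_formBl !cut_formBr.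
have h1 := hU _ _ (up _ hf) (up _ hg); have h2 := hU _ _ (up _ hf) (un _ hg).
have h3 := hU _ _ (un _ hf) (up _ hg); have h4 := hU _ _ (un _ hf) (un _ hg).
move: h1 h2 h3 h4; rewrite !ler_norml => /andP[? ?] /andP[? ?] /andP[? ?] /andP[? ?].
by apply/andP; split; lra.
Qed.

Lemma cut_le_bounded V (a : V -> R) U c f g (A B : R) : 0 < A -> 0 < B -> cut_le a U c ->
  (forall x, `|f x| <= A) -> (forall x, `|g x| <= B) ->
  `|cut_form a U f g| <= 4 * c * (A * B).
Proof.
move=> A0 B0 hU hf hg.
have hs (h : V -> R) (C : R) : 0 < C -> (forall x : V, `|h x| <= C) ->
    forall x, `|C^-1 * h x| <= 1.
  by move=> C0 hh x; rewrite normrM gtr0_norm ?invr_gt0// ler_pdivrMl// mulr1.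
have := cut_le_signed hU (hs _ _ A0 hf) (hs _ _ B0 hg).
rewrite cut_formZ normrM -invfM gtr0_norm ?invr_gt0 ?mulr_gt0//.
by rewrite ler_pdivrMl ?mulr_gt0// mulrC.
Qed.

(* A linear functional on [0,1]^V attains its extrema at indicators. *)
Lemma linear_extreme V (w f : V -> R) c : unit_fun f ->
  (forall S : {set V}, `|\sum_(x in S) w x| <= c) -> `|\sum_x f x * w x| <= c.
Proof.
move=> hf hS; rewrite ler_norml; apply/andP; split.
- apply: le_trans (_ : \sum_(x in [set x | w x < 0]) w x <= _).
    by have := hS [set x | w x < 0]%SET; rewrite ler_norml => /andP[].
  rewrite big_mkcond; apply: ler_sum => x _; rewrite inE.
  have /andP[f0 f1] := hf x; case: ltrP => wx; last by rewrite mulr_ge0.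
  by rewrite ler_niMl// ltW.
- apply: le_trans (_ : _ <= \sum_(x in [set x | 0 < w x]) w x) _; last first.
    by have := hS [set x | 0 < w x]%SET; rewrite ler_norml => /andP[].
  rewrite [leRHS]big_mkcond; apply: ler_sum => x _; rewrite inE.
  have /andP[f0 f1] := hf x; case: ltrP => wx; last by rewrite mulr_ge0_le0.
  by rewrite ler_piMl// ltW.
Qed.

(** The form is linear in [f] and in [g] separately, so each can be replaced in turn by an
    indicator. *)
Lemma cut_le_sets V (a : V -> R) U c :
  (forall S T : {set V}, `|\sum_(x in S) \sum_(y in T) a x * a y * U x y| <= c) ->
  cut_le a U c.
Proof.
move=> hST f g hf hg.
have -> : cut_form a U f g = \sum_x f x * (\sum_y g y * (a x * a y * U x y)).
  by apply: eq_bigr => x _; rewrite mulr_sumr; apply: eq_bigr => y _; ring.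
apply: linear_extreme => // S.
have -> : \sum_(x in S) \sum_y g y * (a x * a y * U x y) =
          \sum_y g y * (\sum_(x in S) a x * a y * U x y).
  by rewrite exchange_big; apply: eq_bigr => y _; rewrite mulr_sumr.
by apply: linear_extreme => // T; rewrite exchange_big.
Qed.

(* A test function on P averages, over the fibres of pi, to one on V. *)
Lemma cut_le_pull V P (pi : P -> V) (z : P -> R) (a : V -> R) U c :
  (forall p, 0 <= z p) -> (forall v, a v = \sum_(p | pi p == v) z p) ->
  cut_le a U c -> cut_le z (fun p q => U (pi p) (pi q)) c.
Proof.
move=> z0 ha hU f g hf hg.
pose av (h : P -> R) v := (a v)^-1 * \sum_(p | pi p == v) z p * h p.
have a0 v : 0 <= a v by rewrite ha sumr_ge0.
(* On a fibre of measure zero [av] takes the default value 0; this is harmless because [z] vanishes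
   there. *)
have avM h v : unit_fun h -> a v * av h v = \sum_(p | pi p == v) z p * h p.
  move=> hh; rewrite /av; have [av0|avn0] := eqVneq (a v) 0.
    rewrite av0 mul0r big1 // => p pv.
    have : a v == 0 by apply/eqP.
    rewrite ha psumr_eq0// => /allP/(_ p (mem_index_enum _)); rewrite pv => /eqP->.
    by rewrite mul0r.
  by rewrite mulVKf.
have uav h : unit_fun h -> unit_fun (av h).
  move=> hh v; have s0 : 0 <= \sum_(p | pi p == v) z p * h p.
    by apply: sumr_ge0 => p _; rewrite mulr_ge0//; case/andP: (hh p).
  rewrite /av mulr_ge0 ?invr_ge0//= mulrC.
  have [av0|avn0] := eqVneq (a v) 0; first by rewrite av0 invr0 mulr0 ler01.
  rewrite ler_pdivrMr ?mul1r ?lt_def ?avn0 ?a0// [leRHS]ha; apply: ler_sum => p _.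
  by case/andP: (hh p) => h0 h1; rewrite ler_piMr.
suff -> : cut_form z (fun p q => U (pi p) (pi q)) f g = cut_form a U (av f) (av g).
  by apply: hU; apply: uav.
rewrite /cut_form (partition_big pi xpredT)//=; apply: eq_bigr => v _.
rewrite exchange_big (partition_big pi xpredT)//=; apply: eq_bigr => w _.
rewrite !avM// exchange_big mulr_suml mulr_suml; apply: eq_bigr => p /eqP <-.
by rewrite mulr_sumr mulr_suml; apply: eq_bigr => q /eqP <-.
Qed.

(** A test function on [V] lifts along [pi] without changing the value of the form. *)
Lemma cut_le_push V P (pi : P -> V) (z : P -> R) (a : V -> R) U c :
  (forall v, a v = \sum_(p | pi p == v) z p) ->
  cut_le z (fun p q => U (pi p) (pi q)) c -> cut_le a U c.
Proof.
move=> ha hU f g hf hg.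
suff -> : cut_form a U f g =
    cut_form z (fun p q => U (pi p) (pi q)) (f \o pi) (g \o pi).
  by apply: hU => p /=; [apply: hf|apply: hg].
rewrite /cut_form [RHS](partition_big pi xpredT)//=; apply: eq_bigr => v _.
rewrite [RHS]exchange_big [RHS](partition_big pi xpredT)//=; apply: eq_bigr => w _.
rewrite !ha exchange_big !mulr_suml; apply: eq_bigr => p /eqP <-.
by rewrite mulr_sumr mulr_suml; apply: eq_bigr => q /eqP <-.
Qed.

End CutForm.

(** * Product expectations and four-cycles *)

Section ProductExpectation.
Context {R : realType} (I V : finType).
Implicit Types (p : I -> V -> R) (H : {ffun I -> V} -> R) (c : R).

(** For probability vectors [p i] this is an expectation over independent coordinates. The law may
    vary with [i], as it does for the coins of a sample. *)
Definition expect p H : R := \sum_(phi : {ffun I -> V}) (\prod_i p i (phi i)) * H phi.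

Definition update (phi : {ffun I -> V}) i x : {ffun I -> V} :=
  [ffun j => if j == i then x else phi j].

Lemma updateE phi i x : update phi i x i = x.
Proof. by rewrite ffunE eqxx. Qed.

Lemma updateN phi i x j : j != i -> update phi i x j = phi j.
Proof. by rewrite ffunE => /negPf->. Qed.

Lemma updateK phi i x : update (update phi i x) i (phi i) = phi.
Proof. by apply/ffunP => j; rewrite !ffunE; case: eqP => [->|]. Qed.

Lemma eq_expect p H H' : H =1 H' -> expect p H = expect p H'.
Proof. by move=> e; apply: eq_bigr => phi _; rewrite e. Qed.

Lemma expectD p H H' : expect p (fun phi => H phi + H' phi) = expect p H + expect p H'.
Proof. by rewrite -big_split; apply: eq_bigr => phi _; rewrite mulrDr. Qed.

Lemma expectB p H H' : expect p (fun phi => H phi - H' phi) = expect p H - expect p H'.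
Proof. by rewrite -sumrB; apply: eq_bigr => phi _; rewrite mulrBr. Qed.

Lemma expectZ p H c : expect p (fun phi => c * H phi) = c * expect p H.
Proof. by rewrite mulr_sumr; apply: eq_bigr => phi _; rewrite mulrCA. Qed.

Lemma expect_sum (J : finType) p (H : J -> {ffun I -> V} -> R) :
  expect p (fun phi => \sum_j H j phi) = \sum_j expect p (H j).
Proof. by rewrite exchange_big; apply: eq_bigr => phi _; rewrite mulr_sumr. Qed.

Variable p : I -> V -> R.
Hypothesis p_ge0 : forall i x, 0 <= p i x.
Hypothesis p_sum1 : forall i, \sum_x p i x = 1.

Lemma prod_meas_ge0 (phi : {ffun I -> V}) : 0 <= \prod_i p i (phi i).
Proof. by apply: prodr_ge0 => i _. Qed.

Lemma sum_prod_meas1 : \sum_(phi : {ffun I -> V}) \prod_i p i (phi i) = 1.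
Proof. by rewrite -bigA_distr_bigA big1. Qed.

Lemma expect_cst c : expect p (fun=> c) = c.
Proof. by rewrite /expect -mulr_suml sum_prod_meas1 mul1r. Qed.

Lemma le_expect H H' : (forall phi, H phi <= H' phi) -> expect p H <= expect p H'.
Proof. by move=> h; apply: ler_sum => phi _; rewrite ler_wpM2l ?prod_meas_ge0. Qed.

Lemma expect_le_cst H c : (forall phi, H phi <= c) -> expect p H <= c.
Proof. by move=> h; rewrite -[leRHS]expect_cst; apply: le_expect. Qed.

Lemma expect_norm_le H c : (forall phi, `|H phi| <= c) -> `|expect p H| <= c.
Proof.
move=> h; apply: le_trans (expect_le_cst h); apply: le_trans (ler_norm_sum _ _ _) _.
by apply: ler_sum => phi _; rewrite normrM ger0_norm ?prod_meas_ge0.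
Qed.

(* The map (phi, x) |-> (update phi i x, phi i) is a measure preserving involution. *)
Lemma expect_resample H i :
  expect p H = expect p (fun phi => \sum_x p i x * H (update phi i x)).
Proof.
pose s (z : {ffun I -> V} * V) := (update z.1 i z.2, z.1 i).
have sK : involutive s.
  by case=> phi x; rewrite /s /= updateK updateE.
rewrite /expect; under [RHS]eq_bigr do rewrite mulr_sumr.
rewrite pair_big/= (reindex_inj (inv_inj sK))/=.
have -> : \sum_(phi : {ffun I -> V}) (\prod_j p j (phi j)) * H phi =
    \sum_(phi : {ffun I -> V}) \sum_x (\prod_j p j (phi j)) * (p i x * H phi).
  apply: eq_bigr => phi _; rewrite -mulr_sumr -mulr_suml p_sum1; ring.
rewrite pair_big/=; apply: eq_bigr => -[phi x] _ /=; rewrite updateK !mulrA.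
congr (_ * _); rewrite (bigD1 i)//= [in RHS](bigD1 i)//= updateE mulrC mulrA.
rewrite -[RHS]mulrA [_ * p i (phi i)]mulrC mulrA; congr (_ * _).
by apply: eq_bigr => j ji; rewrite updateN.
Qed.

(** Invariance under [update] expresses that [H] ignores coordinate [i], so resampling that
    coordinate averages [g] alone. *)
Lemma expect_indep (i : I) (g : V -> R) H :
  (forall phi x, H (update phi i x) = H phi) ->
  expect p (fun phi => g (phi i) * H phi) = (\sum_x p i x * g x) * expect p H.
Proof.
move=> hH; rewrite (expect_resample _ i) -expectZ; apply: eq_expect => phi.
by rewrite mulr_suml; apply: eq_bigr => x _; rewrite updateE hH mulrA.
Qed.

End ProductExpectation.

Section Moments.
Context {R : realType}.

(** The difference of the two sides is the variance of [z]. *)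
Lemma sqr_mean_le (V : finType) (a z : V -> R) : (forall x, 0 <= a x) ->
  \sum_x a x = 1 -> (\sum_x a x * z x) ^+ 2 <= \sum_x a x * z x ^+ 2.
Proof.
move=> a0 a1.
have sqE m : \sum_x a x * (z x - m) ^+ 2 =
    \sum_x a x * z x ^+ 2 - 2 * m * (\sum_x a x * z x) + m ^+ 2 * \sum_x a x.
  rewrite !mulr_sumr -sumrB -big_split; apply: eq_bigr => x _ /=; ring.
have : 0 <= \sum_x a x * (z x - \sum_x a x * z x) ^+ 2.
  by apply: sumr_ge0 => x _; rewrite mulr_ge0 ?sqr_ge0.
rewrite sqE a1; set m := \sum_x a x * z x; set q := \sum_x _ => h; nra.
Qed.

(** Density of the four-cycle with colour classes x, x' and y, y'. *)
Definition cycle4 (V : finType) (a : V -> R) (U : V -> V -> R) : R :=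
  \sum_x \sum_y \sum_x' \sum_y' a x * a y * a x' * a y' *
    (U x y * U x' y * U x y' * U x' y').

Variables (V : finType) (a : V -> R).
Hypotheses (a_ge0 : forall x, 0 <= a x) (a_sum1 : \sum_x a x = 1).

Lemma cycle4E (U : V -> V -> R) : cycle4 a U =
  \sum_y \sum_y' a y * a y' * (\sum_x a x * U x y * U x y') ^+ 2.
Proof.
rewrite /cycle4 exchange_big; apply: eq_bigr => y _ /=.
under eq_bigr do rewrite exchange_big; rewrite exchange_big; apply: eq_bigr => y' _ /=.
rewrite expr2 mulr_suml mulr_sumr; apply: eq_bigr => x _.
rewrite mulr_sumr mulr_sumr; apply: eq_bigr => x' _; ring.
Qed.

Lemma cycle4_ge0 (U : V -> V -> R) : 0 <= cycle4 a U.
Proof.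
rewrite cycle4E; apply: sumr_ge0 => y _; apply: sumr_ge0 => y' _.
by rewrite mulr_ge0 ?sqr_ge0// mulr_ge0.
Qed.

Lemma sqr_unit_le (f x : R) : 0 <= f <= 1 -> (f * x) ^+ 2 <= x ^+ 2.
Proof.
case/andP=> f0 f1; rewrite exprMn ler_piMl ?sqr_ge0//.
by rewrite expr_le1.
Qed.

(** Cauchy-Schwarz over x removes [f]. Once the square is expanded, Cauchy-Schwarz over y and then
    over y' removes the two copies of [g] and leaves the squared codegrees of [cycle4E]. *)
Lemma cut_form_cycle4 (U : V -> V -> R) f g : unit_fun f -> unit_fun g ->
  cut_form a U f g ^+ 4 <= cycle4 a U.
Proof.
move=> hf hg; pose h x := \sum_y a y * g y * U x y.
have -> : cut_form a U f g = \sum_x a x * (f x * h x).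
  apply: eq_bigr => x _; rewrite /h !mulr_sumr; apply: eq_bigr => y _; ring.
have e1 : (\sum_x a x * (f x * h x)) ^+ 2 <= \sum_x a x * h x ^+ 2.
  apply: le_trans (sqr_mean_le _ a_ge0 a_sum1) _; apply: ler_sum => x _.
  by rewrite ler_wpM2l// sqr_unit_le.
pose K y y' := \sum_x a x * U x y * U x y'.
have e2 : \sum_x a x * h x ^+ 2 = \sum_y a y * (g y * \sum_y' a y' * (g y' * K y y')).
  under eq_bigr do rewrite /h expr2 mulr_suml mulr_sumr.
  rewrite exchange_big; apply: eq_bigr => y _ /=.
  under eq_bigr do rewrite mulr_sumr mulr_sumr.
  rewrite exchange_big !mulr_sumr; apply: eq_bigr => y' _ /=.
  rewrite /K !mulr_sumr; apply: eq_bigr => x _; ring.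
rewrite (exprM _ 2 2); apply: (@le_trans _ _ ((\sum_x a x * h x ^+ 2) ^+ 2)).
  by rewrite lerXn2r ?nnegrE ?sqr_ge0// (le_trans _ e1)// sqr_ge0.
rewrite e2 cycle4E; apply: le_trans (sqr_mean_le _ a_ge0 a_sum1) _.
apply: ler_sum => y _; under [leRHS]eq_bigr do rewrite -mulrA.
rewrite -mulr_sumr ler_wpM2l//; apply: le_trans (sqr_unit_le _ (hg y)) _.
apply: le_trans (sqr_mean_le _ a_ge0 a_sum1) _; apply: ler_sum => y' _.
by rewrite ler_wpM2l// sqr_unit_le.
Qed.

(* The fourth root is avoided through t <= eta + t^4 / eta^3. *)
Lemma cut_le_cycle4 (U : V -> V -> R) (eta : R) : 0 < eta ->
  cut_le a U (eta + cycle4 a U / eta ^+ 3).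
Proof.
move=> e0 f g hf hg; set t := `|_|.
have : t ^+ 4 <= cycle4 a U.
  by rewrite (exprM _ 2 2) real_normK ?num_real// -exprM; apply: cut_form_cycle4.
have t0 : 0 <= t by apply: normr_ge0.
have e3 : 0 < eta ^+ 3 by apply: exprn_gt0.
case: (leP t eta) => [te _|et h].
  by apply: le_trans te _; rewrite lerDl divr_ge0 ?cycle4_ge0// ltW.
apply: (@le_trans _ _ (cycle4 a U / eta ^+ 3)); last by rewrite lerDr ltW.
rewrite ler_pdivlMr//; apply: le_trans h; rewrite [leRHS]exprS ler_wpM2l//.
by rewrite lerXn2r ?nnegrE// ltW.
Qed.

(** With x' and y' frozen, the edge between them contributes a factor of at most M, and the other
    three edges form a cut form with test functions bounded by M. *)
Lemma cycle4_le_cut (U : V -> V -> R) (M c : R) : 0 < M ->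
  (forall x y, `|U x y| <= M) -> cut_le a U c -> cycle4 a U <= 4 * c * M ^+ 3.
Proof.
move=> M0 hM hU.
have -> : cycle4 a U = \sum_x' \sum_y' a x' * a y' *
    (U x' y' * cut_form a U (fun x => U x y') (fun y => U x' y)).
  rewrite /cycle4; under eq_bigr do rewrite exchange_big.
  rewrite exchange_big; apply: eq_bigr => x' _ /=.
  under eq_bigr do rewrite exchange_big.
  rewrite exchange_big; apply: eq_bigr => y' _ /=.
  rewrite /cut_form !mulr_sumr; apply: eq_bigr => x _.
  rewrite !mulr_sumr; apply: eq_bigr => y _; ring.
have c0 := cut_le_ge0 hU.
rewrite -[leRHS]mul1r; set B := 4 * c * M ^+ 3.
rewrite -(sum_prod_meas a_sum1) mulr_suml; apply: ler_sum => x _.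
rewrite mulr_suml; apply: ler_sum => y _; rewrite ler_wpM2l ?mulr_ge0// /B.
apply: le_trans (ler_norm _) _; rewrite normrM.
rewrite exprS [leRHS]mulrCA; apply: ler_pM => //.
by rewrite expr2; apply: cut_le_bounded.
Qed.

End Moments.

(** * Counting lemma on a common node set *)

Section Counting.
Context {R : realType}.

(** A product of fibre sums expands into a sum over all psi lying above phi. *)
Lemma expect_push (I V P : finType) (pi : P -> V) (z : P -> R) (a : V -> R)
    (H : {ffun I -> V} -> R) :
  (forall v, a v = \sum_(p | pi p == v) z p) ->
  expect (fun=> a) H = expect (fun=> z) (fun psi => H [ffun i => pi (psi i)]).
Proof.
move=> ha; rewrite /expect.
rewrite [RHS](partition_big (fun psi : {ffun I -> P} => [ffun i => pi (psi i)]) xpredT)//=.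
apply: eq_bigr => phi _.
under eq_bigr do rewrite ha.
rewrite bigA_distr_big_dep/= mulr_suml.
have e (psi : {ffun I -> P}) : (psi \in family (fun i p => pi p == phi i)) =
    ([ffun i => pi (psi i)] == phi).
  apply/familyP/eqP => [h|<- i]; last by rewrite unfold_in ffunE.
  by apply/ffunP => i; rewrite ffunE; have := h i; rewrite unfold_in => /eqP.
by rewrite (eq_bigl _ _ e); apply: eq_bigr => psi /eqP->.
Qed.

(** As [1 <= M], the entries rejected by [P] may be charged a factor [M] too, which makes the bound
    depend on [size s] alone. *)
Lemma norm_prod_le (T : Type) (s : seq T) (P : pred T) (F : T -> R) (M : R) :
  1 <= M -> (forall t, `|F t| <= M) -> `|\prod_(t <- s | P t) F t| <= M ^+ size s.
Proof.
move=> M1 hF; have M0 : 0 <= M by apply: le_trans M1.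
elim: s => [|t s IH]; first by rewrite big_nil normr1.
rewrite big_cons; case: ifP => _; last first.
  by apply: le_trans IH _; rewrite exprS ler_peMl ?exprn_ge0.
by rewrite normrM exprS ler_pM.
Qed.

Variables (V : finType) (a : V -> R) (k : nat).
Hypotheses (a_ge0 : forall x, 0 <= a x) (a_sum1 : \sum_x a x = 1).
Variables (B : bool -> V -> V -> R) (M : R).
Hypotheses (M_ge1 : 1 <= M) (B_le : forall s x y, `|B s x y| <= M).
Notation edge := ('I_k * 'I_k)%type.

(** The tag of an edge selects which of the two kernels evaluates it; the telescoping sum flips one
    tag at a time. *)
Definition edge_prod (s : seq (edge * bool)) (phi : {ffun 'I_k -> V}) :=
  \prod_(z <- s) B z.2 (phi z.1.1) (phi z.1.2).

(* Freezing phi off the endpoints of e, the remaining edges factor into a function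
   of phi e.1 times a function of phi e.2, as none of them joins the two endpoints. *)
Lemma expect_one_edge (U : V -> V -> R) (c : R) (e : edge) (s : seq (edge * bool)) :
  (e.1 < e.2)%N -> {in s, forall z : edge * bool, (z.1.1 < z.1.2)%N && (z.1 != e)} ->
  cut_le a U c ->
  `|expect (fun=> a) (fun phi => U (phi e.1) (phi e.2) * edge_prod s phi)|
    <= 4 * c * (M ^+ size s * M ^+ size s).
Proof.
case: e => i j /= ij hs hU.
rewrite (expect_resample (fun=> a_sum1) _ i) (expect_resample (fun=> a_sum1) _ j).
have ji : j != i by rewrite -val_eqE /= neq_ltn ij orbT.
apply: expect_norm_le => // phi.
pose t (z : edge * bool) := (z.1.1 == i) || (z.1.2 == i).
pose f x := \prod_(z <- s | t z) B z.2 (update phi i x z.1.1) (update phi i x z.1.2).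
pose g y := \prod_(z <- s | ~~ t z) B z.2 (update phi j y z.1.1) (update phi j y z.1.2).
have -> : \sum_y a y * (\sum_x a x *
    (U (update (update phi j y) i x i) (update (update phi j y) i x j) *
     edge_prod s (update (update phi j y) i x))) = cut_form a U f g.
  rewrite /cut_form [RHS]exchange_big; apply: eq_bigr => y _.
  rewrite mulr_sumr; apply: eq_bigr => x _.
  rewrite updateE updateN// updateE.
  have -> : edge_prod s (update (update phi j y) i x) = f x * g y.
    rewrite /edge_prod (bigID t)/=; congr (_ * _).
      rewrite big_seq_cond [RHS]big_seq_cond; apply: eq_bigr => z /andP[zs tz].
      have /andP[zlt ze] := hs z zs.
      (* An edge meeting both i and j would be either [e] itself, which is excluded, or its
         reversal, which is not increasing. *)
      have z1 : z.1.1 != j.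
        apply/eqP => zj; move: tz; rewrite /t zj (negPf ji) /= => /eqP z2.
        by move: zlt; rewrite zj z2 ltnNge ltnW.
      have z2 : z.1.2 != j.
        apply/eqP => zj; move: tz; rewrite /t zj (negPf ji) orbF => /eqP zi.
        by move: ze; rewrite [z.1]surjective_pairing zj zi eqxx.
      by rewrite !ffunE (negPf z1) (negPf z2).
    rewrite big_seq_cond [RHS]big_seq_cond; apply: eq_bigr => z /andP[zs].
    rewrite /t negb_or => /andP[z1 z2].
    by rewrite ![update (update _ _ _) _ _ _]ffunE (negPf z1) (negPf z2).
  ring.
have M0 : 0 < M by apply: lt_le_trans M_ge1.
apply: cut_le_bounded => //; rewrite ?exprn_gt0// => x; exact: norm_prod_le.
Qed.

(** Induction on the edges still to be exchanged: the head of [s] is switched to [B false] and moved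
    into [s']. The move preserves the bound [N] on the total number of edges, so every exchange has
    the same cost. *)
Lemma expect_telescope (c : R) (N : nat) (s : seq edge) (s' : seq (edge * bool)) :
  cut_le a (fun x y => B true x y - B false x y) c ->
  uniq s -> {in s, forall e : edge, (e.1 < e.2)%N} ->
  {in s', forall z : edge * bool, (z.1.1 < z.1.2)%N && (z.1 \notin s)} ->
  (size s + size s' <= N)%N ->
  `|expect (fun=> a) (fun phi => edge_prod s' phi * edge_prod [seq (e, true) | e <- s] phi)
    - expect (fun=> a) (fun phi => edge_prod s' phi * edge_prod [seq (e, false) | e <- s] phi)|
    <= (size s)%:R * (4 * c * (M ^+ N * M ^+ N)).
Proof.
move=> hc; elim: s s' => [|e s IH] s' /=; first by rewrite subrr normr0 mul0r.
move=> /andP[es us] hs hs' hN.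
have c0 := cut_le_ge0 hc.
have M0 : 0 <= M by apply: le_trans M_ge1.
pose mid := expect (fun=> a) (fun phi => edge_prod ((e, false) :: s') phi *
  edge_prod [seq (e, true) | e <- s] phi).
rewrite -(subrKA mid) mulrSr addrC mulrDl mul1r addrC.
apply: le_trans (ler_normD _ _) _; rewrite [leRHS]addrC; apply: lerD.
  rewrite /mid -expectB.
  have -> : (fun phi => edge_prod s' phi * edge_prod ((e, true) :: [seq (e, true) | e <- s]) phi -
     edge_prod ((e, false) :: s') phi * edge_prod [seq (e, true) | e <- s] phi) =
     (fun phi => (B true (phi e.1) (phi e.2) - B false (phi e.1) (phi e.2)) *
        edge_prod (s' ++ [seq (e, true) | e <- s]) phi).
    apply/funext => phi; rewrite /edge_prod !big_cons big_cat /=; ring.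
  apply: le_trans (expect_one_edge (U := fun x y => B true x y - B false x y) _ _ hc) _.
  - by apply: hs; rewrite mem_head.
  - move=> z; rewrite mem_cat => /orP[/hs'|/mapP[e' e's ->]] /=.
      by rewrite in_cons negb_or => /and3P[-> ->].
    rewrite hs ?inE ?e's ?orbT//=; apply: contraNneq es => <-; exact: e's.
  - rewrite ler_wpM2l ?mulr_ge0// size_cat size_map.
    have h : M ^+ (size s' + size s) <= M ^+ N.
      by apply: ler_weXn2l => //; rewrite addnC (leq_trans _ hN)// leq_add2r.
    by apply: ler_pM; rewrite ?exprn_ge0.
have -> : expect (fun=> a) (fun phi => edge_prod s' phi *
    edge_prod ((e, false) :: [seq (e, false) | e <- s]) phi) =
  expect (fun=> a) (fun phi => edge_prod ((e, false) :: s') phi *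
    edge_prod [seq (e, false) | e <- s] phi).
  by apply: eq_expect => phi; rewrite /edge_prod !big_cons /=; ring.
apply: IH => //.
- by move=> e' e's; apply: hs; rewrite inE e's orbT.
- move=> z; rewrite inE => /orP[/eqP->/=|/hs' /andP[-> ]].
    by rewrite es andbT; apply: hs; rewrite mem_head.
  by rewrite inE negb_or => /andP[].
- by rewrite /= addnS -addSn.
Qed.

End Counting.

(** * Overlays and the counting lemma *)

Section Overlay.
Context {R : realType}.
Implicit Types G H : wgraph R.

Lemma total_nodew_gt0 G : 0 < total_nodew G.
Proof.
have /card_gt0P[i _] := node_gt0 G.
rewrite /total_nodew (bigD1 i)//= ltr_pwDl ?nodew_gt0//.
by apply: sumr_ge0 => j _; rewrite ltW ?nodew_gt0.
Qed.

Lemma normalized_gt0 G (i : node G) : 0 < normalized_nodew i.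
Proof. by rewrite divr_gt0 ?nodew_gt0 ?total_nodew_gt0. Qed.

Lemma normalized_ge0 G (i : node G) : 0 <= normalized_nodew i.
Proof. exact/ltW/normalized_gt0. Qed.

Lemma normalized_sum1 G : \sum_(i : node G) normalized_nodew i = 1.
Proof. by rewrite -mulr_suml divff// gt_eqF// total_nodew_gt0. Qed.

Lemma sum_fibre_fst (V W : finType) (F : V * W -> R) v :
  \sum_(p | p.1 == v) F p = \sum_w F (v, w).
Proof.
transitivity (\sum_(i | i == v) \sum_w F (i, w)); last by rewrite big_pred1_eq.
by rewrite pair_big; apply: eq_big => [[x y]|[x y] _]//=; rewrite andbT.
Qed.

Lemma sum_fibre_snd (V W : finType) (F : V * W -> R) w :
  \sum_(p | p.2 == w) F p = \sum_v F (v, w).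
Proof.
transitivity (\sum_v \sum_(j | j == w) F (v, j)).
  by rewrite pair_big; apply: eq_big => [[x y]|[x y] _].
by apply: eq_bigr => v _; rewrite big_pred1_eq.
Qed.

Definition overlay_meas G H (X : node G -> node H -> R) (p : node G * node H) : R :=
  X p.1 p.2.

Definition overlay_ker G H (p q : node G * node H) : R :=
  edgew p.1 q.1 - edgew p.2 q.2.

Section Fixed.
Variables (G H : wgraph R) (X : node G -> node H -> R).
Hypothesis hX : fractional_overlay X.

Lemma overlay_meas_ge0 p : 0 <= overlay_meas X p.
Proof. by case: hX => h _ _; apply: h. Qed.

Lemma overlay_fst i : normalized_nodew i = \sum_(p | p.1 == i) overlay_meas X p.
Proof. by case: hX => _ h _; rewrite sum_fibre_fst h. Qed.

Lemma overlay_snd u : normalized_nodew u = \sum_(p | p.2 == u) overlay_meas X p.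
Proof. by case: hX => _ _ h; rewrite sum_fibre_snd h. Qed.

Lemma overlay_sum1 : \sum_p overlay_meas X p = 1.
Proof.
rewrite -(normalized_sum1 G) (partition_big fst xpredT)//=.
by apply: eq_bigr => i _; rewrite -overlay_fst.
Qed.

Lemma overlay_cutE S T : `|cut_weight (fun p : node G * node H => X p.1 p.2)
     (fun p q => edgew p.1 q.1) S T -
   cut_weight (fun p : node G * node H => X p.1 p.2)
     (fun p q => edgew p.2 q.2) S T| / (\sum_(p : node G * node H) X p.1 p.2) ^+ 2 =
  `|\sum_(p in S) \sum_(q in T) overlay_meas X p * overlay_meas X q * overlay_ker p q|.
Proof.
rewrite [\sum_(p : _ * _) _]overlay_sum1 expr1n divr1 /cut_weight -sumrB.
congr `|_|; apply: eq_bigr => p _.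
by rewrite -sumrB; apply: eq_bigr => q _; rewrite -mulrBr.
Qed.

Lemma overlay_dist_le c : cut_le (overlay_meas X) (@overlay_ker G H) c ->
  overlay_dist X <= c.
Proof.
move=> h; have c0 := cut_le_ge0 h.
apply: bigmax_le => // S _; apply: bigmax_le => // T _; rewrite overlay_cutE.
pose ind (A : {set node G * node H}) (p : node G * node H) : R := (p \in A)%:R.
have hind A : unit_fun (ind A) by move=> p; rewrite /ind; case: (_ \in _); rewrite ?lexx ler01.
have := h _ _ (hind S) (hind T); congr (_ <= _); congr `|_|.
rewrite /cut_form [RHS]big_mkcond; apply: eq_bigr => p _; rewrite /ind.
case: (p \in S); last by apply: big1 => q _; rewrite mulr0 mul0r mul0r.
rewrite [RHS]big_mkcond; apply: eq_bigr => q _.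
by case: (q \in T); rewrite ?mulr1 ?mulr0 ?mul0r.
Qed.

Lemma cut_le_overlay : cut_le (overlay_meas X) (@overlay_ker G H) (overlay_dist X).
Proof.
apply: cut_le_sets => S T; rewrite -overlay_cutE.
apply: le_trans (le_bigmax _ _ S); exact: (le_bigmax _ _ T).
Qed.

Lemma delta_cut_le c : cut_le (overlay_meas X) (@overlay_ker G H) c ->
  delta_cut G H <= c.
Proof.
move=> /overlay_dist_le; apply: le_trans; apply: ge_inf; last by exists X.
exists 0 => _ [Y _ <-]; rewrite /overlay_dist /cut_dist.
exact: bigmax_ge_id.
Qed.

End Fixed.

(** The independent coupling. It shows that the infimum in [delta_cut] runs over a nonempty set, and
    it suffices for the trivial bound [delta_cut_bounded]. *)
Lemma product_overlay G H :
  fractional_overlay (fun (i : node G) (u : node H) => normalized_nodew i * normalized_nodew u).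
Proof.
split=> [i u|i|u]; first by rewrite mulr_ge0 ?normalized_ge0.
  by rewrite -mulr_sumr normalized_sum1 mulr1.
by rewrite -mulr_suml normalized_sum1 mul1r.
Qed.

(** The strict inequality yields an overlay directly from the infimum, without a compactness
    argument for a minimiser. *)
Lemma delta_cut_lt G H c : delta_cut G H < c ->
  exists2 X : node G -> node H -> R, fractional_overlay X &
    cut_le (overlay_meas X) (@overlay_ker G H) c.
Proof.
move=> /inf_lt[]; first by eexists; eexists; [exact: product_overlay|reflexivity].
move=> _ [X hX <-] /ltW hc; exists X => //.
exact: cut_le_trans hc (cut_le_overlay hX).
Qed.

Lemma delta_cut_bounded G H (C : R) : (forall i j : node G, `|edgew i j| <= C) ->
  (forall i j : node H, `|edgew i j| <= C) -> delta_cut G H <= 2 * C.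
Proof.
move=> hG hH; apply: (delta_cut_le (product_overlay G H)).
apply: cut_le_sup => [p||p q].
- exact: overlay_meas_ge0 (product_overlay G H) _.
- exact: overlay_sum1 (product_overlay G H).
- rewrite mulrDl mul1r; apply: le_trans (ler_normB _ _) _; exact: lerD.
Qed.

(* The overlays of (G, F) and (H, F) are glued along F, conditionally independently. *)
Lemma delta_cut_triangle G H F : delta_cut G H <= delta_cut G F + delta_cut H F.
Proof.
apply/ler_addgt0Pr => e e0; have e2 : 0 < e / 2 by lra.
have [X hX cX] : exists2 X : node G -> node F -> R, fractional_overlay X &
    cut_le (overlay_meas X) (@overlay_ker G F) (delta_cut G F + e / 2).
  by apply: delta_cut_lt; rewrite ltrDl.
have [Y hY cY] : exists2 Y : node H -> node F -> R, fractional_overlay Y &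
    cut_le (overlay_meas Y) (@overlay_ker H F) (delta_cut H F + e / 2).
  by apply: delta_cut_lt; rewrite ltrDl.
have -> : delta_cut G F + delta_cut H F + e =
  (delta_cut G F + e / 2) + (delta_cut H F + e / 2) by field.
pose z (t : (node G * node H) * node F) : R :=
  X t.1.1 t.2 * Y t.1.2 t.2 / normalized_nodew t.2.
have [X0 X1 X2] := hX; have [Y0 Y1 Y2] := hY.
have z0 t : 0 <= z t by rewrite !mulr_ge0 ?invr_ge0 ?normalized_ge0.
pose Z i v := \sum_u z (i, v, u).
have an0 (u : node F) : normalized_nodew u != 0 by rewrite gt_eqF ?normalized_gt0.
have hzX (q : node G * node F) : overlay_meas X q = \sum_(t | (t.1.1, t.2) == q) z t.
  case: q => i u; rewrite /overlay_meas /=.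
  under eq_bigl do rewrite xpair_eqE.
  rewrite -(pair_big (fun p => p.1 == i) (fun w => w == u)
    (fun p w => X p.1 w * Y p.2 w / normalized_nodew w))/=.
  under eq_bigr do rewrite big_pred1_eq.
  rewrite (sum_fibre_fst (fun p => X p.1 u * Y p.2 u / normalized_nodew u))/=.
  by rewrite -mulr_suml -mulr_sumr Y2 mulfK.
have hzY (q : node H * node F) : overlay_meas Y q = \sum_(t | (t.1.2, t.2) == q) z t.
  case: q => v u; rewrite /overlay_meas /=.
  under eq_bigl do rewrite xpair_eqE.
  rewrite -(pair_big (fun p => p.2 == v) (fun w => w == u)
    (fun p w => X p.1 w * Y p.2 w / normalized_nodew w))/=.
  under eq_bigr do rewrite big_pred1_eq.
  rewrite (sum_fibre_snd (fun p => X p.1 u * Y p.2 u / normalized_nodew u))/=.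
  by rewrite -mulr_suml -mulr_suml X2 mulrAC divff// mul1r.
have hZ : fractional_overlay Z.
  split=> [i v|i|v]; first by apply: sumr_ge0.
    rewrite /Z exchange_big -X1 /=; apply: eq_bigr => u _.
    by rewrite /z /= -mulr_suml -mulr_sumr Y2 mulfK.
  rewrite /Z exchange_big -Y1 /=; apply: eq_bigr => u _.
  by rewrite /z /= -mulr_suml -mulr_suml X2 mulrAC divff// mul1r.
(* The estimate is made on triples and pushed down to pairs: on triples the edgeweights of [F] occur
   in both kernels and cancel in their difference. *)
apply: (delta_cut_le hZ); apply: (@cut_le_push _ _ _ fst z) => [p|].
  by rewrite sum_fibre_fst; case: p.
have := cut_leB (cut_le_pull z0 hzX cX) (cut_le_pull z0 hzY cY).
by apply: eq_cut_le => // s t; rewrite /overlay_ker/=; ring.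
Qed.

Definition sedges (F : sgraph) : seq ('I_(num_vert F) * 'I_(num_vert F)) :=
  [seq e : 'I_(num_vert F) * 'I_(num_vert F) <- index_enum _ | (e.1 < e.2)%N && adj e.1 e.2].

(** Distributing the power of the total nodeweight over the nodes of [F] normalises each nodeweight,
    so the density is an expectation over independent random nodes. *)
Lemma hom_densityE F G : hom_density F G =
  expect (fun=> @normalized_nodew R G)
    (fun phi => \prod_(e <- sedges F) edgew (phi e.1) (phi e.2)).
Proof.
rewrite /hom_density /expect mulr_sumr; apply: eq_bigr => phi _.
rewrite mulrA big_filter; congr (_ * _).
by rewrite big_split/= big_const_ord iter_mulr_1 exprVn mulrC.
Qed.

Lemma hom_density_dist F G H c (M : R) : 1 <= M ->
  (forall i j : node G, `|edgew i j| <= M) -> (forall i j : node H, `|edgew i j| <= M) ->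
  delta_cut G H < c ->
  `|hom_density F G - hom_density F H| <=
    (size (sedges F))%:R * (4 * c * (M ^+ size (sedges F) * M ^+ size (sedges F))).
Proof.
move=> M1 hG hH /delta_cut_lt[X hX cX].
rewrite !hom_densityE (expect_push _ (overlay_fst hX)) (expect_push _ (overlay_snd hX)).
pose B (s : bool) (p q : node G * node H) := if s then edgew p.1 q.1 else edgew p.2 q.2.
have Bcut : cut_le (overlay_meas X) (fun p q => B true p q - B false p q) c by [].
have e1 : expect (fun=> overlay_meas X) (fun psi => \prod_(e <- sedges F)
      edgew ([ffun i => (psi i).1] e.1) ([ffun i => (psi i).1] e.2)) =
    expect (fun=> overlay_meas X) (fun psi =>
      edge_prod B [::] psi * edge_prod B [seq (e, true) | e <- sedges F] psi).
  apply: eq_expect => psi; rewrite /edge_prod big_nil mul1r big_map.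
  by apply: eq_bigr => e _; rewrite !ffunE.
have e2 : expect (fun=> overlay_meas X) (fun psi => \prod_(e <- sedges F)
      edgew ([ffun i => (psi i).2] e.1) ([ffun i => (psi i).2] e.2)) =
    expect (fun=> overlay_meas X) (fun psi =>
      edge_prod B [::] psi * edge_prod B [seq (e, false) | e <- sedges F] psi).
  apply: eq_expect => psi; rewrite /edge_prod big_nil mul1r big_map.
  by apply: eq_bigr => e _; rewrite !ffunE.
rewrite e1 e2; apply: expect_telescope => //.
- exact: overlay_meas_ge0 hX.
- exact: overlay_sum1 hX.
- by case=> p q /=; rewrite /B.
- by rewrite filter_uniq// index_enum_uniq.
- by move=> e; rewrite mem_filter => /andP[/andP[]].
- by rewrite addn0.
Qed.

Lemma cut_cauchy_left_convergent (G : nat -> wgraph R) :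
  bounded_edgew G -> cut_cauchy G -> left_convergent G.
Proof.
move=> [C hC] hG F; apply/cauchy_cvgP/cauchy_exP => eps eps0.
pose M := Num.max C 1; have M1 : 1 <= M by rewrite le_max lexx orbT.
have hM n i j : `|@edgew R (G n) i j| <= M by rewrite le_max hC.
have M0 : 0 < M by apply: lt_le_trans M1.
set m := size (sedges F).
(* Adding 1 keeps [K] positive when [F] has no edges. *)
pose K := m%:R * (4 * (M ^+ m * M ^+ m)) + 1.
have K0 : 0 < K by rewrite ltr_wpDl// !mulr_ge0// exprn_ge0// ltW.
have [N hN] := hG _ (divr_gt0 eps0 K0).
exists (hom_density F (G N)); exists N => // n /= Nn; rewrite /ball/=.
apply: le_lt_trans (hom_density_dist F M1 (hM N) (hM n) (hN _ _ (leqnn N) Nn)) _.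
rewrite -/m; have -> : m%:R * (4 * (eps / K) * (M ^+ m * M ^+ m)) =
  eps * ((m%:R * (4 * (M ^+ m * M ^+ m))) / K) by ring.
by rewrite gtr_pMr// ltr_pdivrMr// mul1r /K ltrDl.
Qed.

End Overlay.

(** * Weak regularity and coupling *)

Section WeakRegularity.
Context {R : realType}.

(** Each refinement records membership in two sets, giving 4^n types. The type depends on [n] only,
    so its size is uniform over all graphs. *)
Fixpoint split_type (n : nat) : finType :=
  if n is m.+1 then (split_type m * (bool * bool))%type else unit.

Variables (V : finType) (a : V -> R) (b : V -> V -> R) (C : R).
Hypotheses (a_ge0 : forall x, 0 <= a x) (a_sum1 : \sum_x a x = 1).
Hypothesis b_le : forall x y, `|b x y| <= C.

Definition energy (U : V -> V -> R) : R := \sum_x \sum_y a x * a y * U x y ^+ 2.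

Lemma energy_ge0 U : 0 <= energy U.
Proof.
by apply: sumr_ge0 => x _; apply: sumr_ge0 => y _; rewrite mulr_ge0 ?sqr_ge0 ?mulr_ge0.
Qed.

(** Expanding the square gives [energy U - 2 c^2 + c^2 q], where q is the measure of S x T and hence
    at most 1. *)
Lemma energy_decrement (U : V -> V -> R) (S T : {set V}) (c : R) :
  c = \sum_(x in S) \sum_(y in T) a x * a y * U x y ->
  energy (fun x y => U x y - c * (x \in S)%:R * (y \in T)%:R) <= energy U - c ^+ 2.
Proof.
move=> hc.
have e1 : c = \sum_x \sum_y a x * a y * ((x \in S)%:R * (y \in T)%:R * U x y).
  rewrite hc big_mkcond; apply: eq_bigr => x _; case: (x \in S); last first.
    by rewrite big1// => y _; rewrite !mul0r mulr0.
  rewrite big_mkcond; apply: eq_bigr => y _.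
  by case: (y \in T); rewrite !(mul1r, mul0r, mulr0).
have -> : energy (fun x y => U x y - c * (x \in S)%:R * (y \in T)%:R) =
    energy U - 2 * c * (\sum_x \sum_y a x * a y * ((x \in S)%:R * (y \in T)%:R * U x y)) +
    c ^+ 2 * (\sum_x \sum_y a x * a y * ((x \in S)%:R * (y \in T)%:R)).
  rewrite /energy !mulr_sumr -sumrB -big_split; apply: eq_bigr => x _ /=.
  rewrite !mulr_sumr -sumrB -big_split; apply: eq_bigr => y _ /=.
  by case: (x \in S); case: (y \in T) => /=; ring.
rewrite -e1.
have : \sum_x \sum_y a x * a y * ((x \in S)%:R * (y \in T)%:R) <= 1.
  rewrite -[leRHS](sum_prod_meas a_sum1); apply: ler_sum => x _; apply: ler_sum => y _.
  rewrite ler_piMr ?mulr_ge0//.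
  by case: (x \in S); case: (y \in T); rewrite ?mulr0 ?mulr1 ?ler01.
set q := \sum_x _ => q1; have := sqr_ge0 c; nra.
Qed.

(** While some S, T witness a cut above [eps], subtracting the corresponding multiple of the
    indicator of S x T lowers the energy by at least [eps ^+ 2]; the initial energy is at most
    [C ^+ 2]. *)
Lemma greedy_regularity (eps : R) (n : nat) : 0 < eps ->
  (exists (tau : V -> split_type n) (w : split_type n -> split_type n -> R),
     cut_le a (fun x y => b x y - w (tau x) (tau y)) eps) \/
  (exists (tau : V -> split_type n) (w : split_type n -> split_type n -> R),
     energy (fun x y => b x y - w (tau x) (tau y)) <= C ^+ 2 - n%:R * eps ^+ 2).
Proof.
move=> eps0; elim: n => [|n IH].
  right; exists (fun=> tt), (fun _ _ => 0); rewrite mul0r subr0.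
  rewrite -[leRHS]mul1r -(sum_prod_meas a_sum1) mulr_suml; apply: ler_sum => x _.
  rewrite mulr_suml; apply: ler_sum => y _; rewrite subr0 ler_wpM2l ?mulr_ge0//.
  by rewrite -real_normK ?num_real// lerXn2r ?nnegrE// (le_trans _ (b_le x y)).
(* If the process succeeds early, an idle refinement pads the solution to the next type. *)
have ext (tau : V -> split_type n) (w : split_type n -> split_type n -> R) :
    cut_le a (fun x y => b x y - w (tau x) (tau y)) eps ->
    exists (tau : V -> split_type n.+1) (w : split_type n.+1 -> split_type n.+1 -> R),
     cut_le a (fun x y => b x y - w (tau x) (tau y)) eps.
  by move=> h; exists (fun x => (tau x, (true, true))), (fun t t' => w t.1 t'.1).
case: IH => [[tau [w /ext]]|[tau [w hw]]]; first by left.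
pose U x y := b x y - w (tau x) (tau y).
case: (pselect (exists S T : {set V},
    eps < `|\sum_(x in S) \sum_(y in T) a x * a y * U x y|)) => [[S [T hST]]|hn].
  right; set c := \sum_(x in S) _ in hST.
  exists (fun x => (tau x, (x \in S, x \in T))).
  exists (fun t t' : (split_type n * (bool * bool))%type =>
    w t.1 t'.1 + c * (t.2.1 : bool)%:R * (t'.2.2 : bool)%:R) => /=.
  have := @energy_decrement U S T c erefl.
  rewrite [X in X <= _ -> _](_ : _ = energy (fun x y => b x y -
      (w (tau x) (tau y) + c * (x \in S)%:R * (y \in T)%:R))); last first.
    by apply: eq_bigr => x _; apply: eq_bigr => y _; rewrite /U; congr (_ * _ ^+ 2); ring.
  move=> h; apply: le_trans h _.
  have : eps ^+ 2 <= c ^+ 2.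
    by rewrite -[leRHS]real_normK ?num_real// lerXn2r ?nnegrE//; exact: ltW.
  by move: hw; rewrite -/U mulrSr => *; lra.
left; apply: (ext tau w); apply: cut_le_sets => S T; rewrite leNgt; apply/negP => h.
by apply: hn; exists S, T.
Qed.

Section Average.
Variables (T : finType) (tau : V -> T).

Definition block_meas t : R := \sum_(x | tau x == t) a x.

Definition block_mean t t' : R := (block_meas t)^-1 * (block_meas t')^-1 *
  \sum_(x | tau x == t) \sum_(y | tau y == t') a x * a y * b x y.

Lemma block_meas_ge0 t : 0 <= block_meas t.
Proof. exact: sumr_ge0. Qed.

Lemma block_sum_le t t' :
  `|\sum_(x | tau x == t) \sum_(y | tau y == t') a x * a y * b x y| <=
  block_meas t * block_meas t' * C.
Proof.
rewrite /block_meas mulr_suml mulr_suml; apply: le_trans (ler_norm_sum _ _ _) _.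
apply: ler_sum => x _; rewrite mulr_sumr mulr_suml.
apply: le_trans (ler_norm_sum _ _ _) _; apply: ler_sum => y _.
by rewrite normrM ger0_norm ?mulr_ge0// ler_wpM2l ?mulr_ge0.
Qed.

Lemma block_meanE t t' : block_meas t * block_meas t' * block_mean t t' =
  \sum_(x | tau x == t) \sum_(y | tau y == t') a x * a y * b x y.
Proof.
(* If one of the blocks is null, the double sum vanishes by [block_sum_le], in agreement with the
   default value of the mean. *)
rewrite /block_mean -invfM; have [z|nz] := eqVneq (block_meas t * block_meas t') 0.
  have := block_sum_le t t'; rewrite z !mul0r normr_le0 => /eqP->.
  by [].
by rewrite mulVKf.
Qed.

Lemma block_mean_le t t' : 0 <= C -> `|block_mean t t'| <= C.
Proof.
move=> C0; rewrite /block_mean -invfM; have := block_sum_le t t'.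
set m := _ * block_meas t'; have m0 : 0 <= m by rewrite mulr_ge0 ?block_meas_ge0.
have [->|nz] := eqVneq m 0; first by rewrite invr0 !mul0r normr0.
have mp : 0 < m by rewrite lt_def nz m0.
by rewrite normrM gtr0_norm ?invr_gt0// ler_pdivrMl.
Qed.

(* Averaging over blocks fixes step kernels and is a contraction of the cut norm. *)
Lemma cut_le_block_mean (w : T -> T -> R) (c : R) :
  cut_le a (fun x y => b x y - w (tau x) (tau y)) c ->
  cut_le a (fun x y => b x y - block_mean (tau x) (tau y)) (c + c).
Proof.
move=> h.
(* Against test functions that are constant on blocks, averaging does not change the form. *)
have hT : cut_le block_meas (fun t t' => block_mean t t' - w t t') c.
  move=> f g hf hg.
  suff -> : cut_form block_meas (fun t t' => block_mean t t' - w t t') f g =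
      cut_form a (fun x y => b x y - w (tau x) (tau y)) (f \o tau) (g \o tau).
    by apply: h => x /=; [apply: hf|apply: hg].
  rewrite /cut_form [RHS](partition_big tau xpredT)//=; apply: eq_bigr => t _.
  rewrite [RHS]exchange_big [RHS](partition_big tau xpredT)//=; apply: eq_bigr => t' _.
  have -> : block_meas t * f t * (block_meas t' * g t') * (block_mean t t' - w t t') =
      f t * g t' * (block_meas t * block_meas t' * block_mean t t' -
        block_meas t * block_meas t' * w t t') by ring.
  rewrite block_meanE /block_meas exchange_big mulr_suml mulr_suml.
  rewrite exchange_big -sumrB mulr_sumr [RHS]exchange_big; apply: eq_bigr => x /eqP xt.
  rewrite mulr_sumr mulr_suml -sumrB mulr_sumr; apply: eq_bigr => y /eqP yt.
  by rewrite xt yt; ring.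
have hp := cut_le_pull a_ge0 (fun t => erefl) hT.
by apply: eq_cut_le (cut_leB h hp) => // x y /=; ring.
Qed.

End Average.

(** The hypothesis on [K] would make the energy negative in the second alternative of
    [greedy_regularity]. The greedy step kernel has no useful sup bound; its block means do, at the
    price of doubling [eps]. *)
Lemma weak_regularity (eps : R) (K : nat) : 0 < eps -> C ^+ 2 < K%:R * eps ^+ 2 ->
  0 <= C ->
  exists (tau : V -> split_type K) (w : split_type K -> split_type K -> R),
    (forall t t', `|w t t'| <= C) /\
    cut_le a (fun x y => b x y - w (tau x) (tau y)) (eps + eps).
Proof.
move=> eps0 hK C0; case: (greedy_regularity K eps0) => [[tau [w h]]|[tau [w h]]].
  exists tau, (block_mean tau); split; first by move=> t t'; exact: block_mean_le.
  exact: cut_le_block_mean h.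
by have := energy_ge0 (fun x y => b x y - w (tau x) (tau y)); lra.
Qed.

End WeakRegularity.

Section Coupling.
Context {R : realType} (T : finType).

(* In each type t the mass min (mu t, nu t) is coupled proportionally to a and q; the
   leftover marginals ra and rq, of total mass rho, are coupled independently (if rho = 0
   they vanish, so the junk value rho^-1 = 0 is harmless). *)
Lemma typed_coupling (V I : finType) (a : V -> R) (q : I -> R)
    (tau : V -> T) (sigma : I -> T) :
  (forall x, 0 <= a x) -> \sum_x a x = 1 -> (forall i, 0 <= q i) -> \sum_i q i = 1 ->
  exists Z : V -> I -> R,
    [/\ forall x i, 0 <= Z x i,
        forall x, \sum_i Z x i = a x,
        forall i, \sum_x Z x i = q i &
        \sum_x \sum_i Z x i * (tau x != sigma i)%:R <=
          \sum_t `|block_meas a tau t - block_meas q sigma t|].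
Proof.
move=> a0 a1 q0 q1.
set mu := block_meas a tau; set nu := block_meas q sigma.
have mu0 t : 0 <= mu t by exact: block_meas_ge0.
have nu0 t : 0 <= nu t by exact: block_meas_ge0.
pose m t := Num.min (mu t) (nu t).
have m0 t : 0 <= m t by rewrite le_min mu0 nu0.
have mmu t : m t <= mu t by rewrite ge_min lexx.
have mnu t : m t <= nu t by rewrite ge_min lexx orbT.
have mE (n : T -> R) t : m t <= n t -> n t * (m t / n t) = m t.
  move=> mn; have [z|nz] := eqVneq (n t) 0; last by rewrite mulrC divfK.
  by rewrite z mul0r; apply/eqP; rewrite eq_sym eq_le -{1}z mn m0.
have r1 (n : T -> R) t : m t <= n t -> 0 <= n t -> m t / n t <= 1.
  move=> mn n0; have [->|nz] := eqVneq (n t) 0; first by rewrite invr0 mulr0 ler01.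
  by rewrite ler_pdivrMr ?mul1r// lt_def nz n0.
pose ra x := a x * (1 - m (tau x) / mu (tau x)).
pose rq i := q i * (1 - m (sigma i) / nu (sigma i)).
pose rho := 1 - \sum_t m t.
have ra0 x : 0 <= ra x by rewrite mulr_ge0// subr_ge0 r1.
have rq0 i : 0 <= rq i by rewrite mulr_ge0// subr_ge0 r1.
have sra : \sum_x ra x = rho.
  under eq_bigr do rewrite /ra mulrBr mulr1.
  rewrite sumrB a1 (partition_big tau xpredT)//=; congr (_ - _); apply: eq_bigr => t _.
  rewrite -[RHS](mE mu)// mulr_suml; by apply: eq_bigr => x /eqP->.
have srq : \sum_i rq i = rho.
  under eq_bigr do rewrite /rq mulrBr mulr1.
  rewrite sumrB q1 (partition_big sigma xpredT)//=; congr (_ - _); apply: eq_bigr => t _.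
  rewrite -[RHS](mE nu)// mulr_suml; by apply: eq_bigr => x /eqP->.
have rho0 : 0 <= rho by rewrite -sra sumr_ge0.
have rV (c : R) : (rho = 0 -> c = 0) -> c * rho / rho = c.
  move=> hc; have [z|nz] := eqVneq rho 0; last by rewrite mulfK.
  by rewrite hc// !mul0r.
have ra_rho x : rho = 0 -> ra x = 0.
  move=> z; move/eqP: sra; rewrite z psumr_eq0// => /allP/(_ x (mem_index_enum _)).
  by move/eqP.
have rq_rho i : rho = 0 -> rq i = 0.
  move=> z; move/eqP: srq; rewrite z psumr_eq0// => /allP/(_ i (mem_index_enum _)).
  by move/eqP.
pose Z1 x i := (tau x == sigma i)%:R * (a x * q i * (m (tau x) / mu (tau x) / nu (tau x))).
exists (fun x i => Z1 x i + ra x * rq i / rho); split.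
- move=> x i; apply: addr_ge0; last by rewrite divr_ge0// mulr_ge0.
  by rewrite mulr_ge0 ?ler0n// mulr_ge0 ?(mulr_ge0 (a0 x))// divr_ge0// divr_ge0.
- move=> x; rewrite big_split/= -mulr_suml -mulr_sumr srq rV//; last exact: ra_rho.
  have -> : \sum_i Z1 x i = a x * (m (tau x) / mu (tau x)).
    have -> : \sum_i Z1 x i = nu (tau x) * (a x * (m (tau x) / mu (tau x) / nu (tau x))).
      rewrite /nu /block_meas mulr_suml [RHS]big_mkcond; apply: eq_bigr => i _.
      by rewrite /Z1 eq_sym; case: eqP => _; rewrite ?mul0r// mul1r -/nu; ring.
    rewrite mulrCA; congr (_ * _).
    rewrite [X in _ * X]mulrAC mulrA mE//.
  rewrite /ra; ring.
- move=> i; rewrite big_split/= -!mulr_suml sra.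
  have -> : rho * rq i / rho = rq i by rewrite [rho * _]mulrC rV//; exact: rq_rho.
  have -> : \sum_x Z1 x i = q i * (m (sigma i) / nu (sigma i)).
    have -> : \sum_x Z1 x i = mu (sigma i) *
        (q i * (m (sigma i) / mu (sigma i) / nu (sigma i))).
      rewrite /mu /block_meas mulr_suml [RHS]big_mkcond; apply: eq_bigr => x _.
      rewrite /Z1; case: eqP => [->|_]; rewrite ?mul0r// mul1r -/mu; ring.
    rewrite mulrCA; congr (_ * _).
    by rewrite mulrA mE.
  rewrite /rq; ring.
(* [Z1] joins equal types only, so the mismatch is at most the leftover mass [rho], which is the sum
   of [mu t - m t] over t. *)
- apply: (@le_trans _ _ rho).
    have : \sum_x \sum_i ra x * rq i / rho = rho.
      under eq_bigr do rewrite -mulr_suml -mulr_sumr.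
      by rewrite -!mulr_suml sra srq rV.
    move=> {2}<-; apply: ler_sum => x _; apply: ler_sum => i _; rewrite /Z1.
    have h : 0 <= ra x * rq i / rho by rewrite divr_ge0// mulr_ge0.
    by case: eqP => _ /=; rewrite ?mulr0// mul0r add0r mulr1.
  rewrite /rho -a1 (partition_big tau xpredT)//= -sumrB; apply: ler_sum => t _.
  rewrite -/(block_meas a tau t) -/mu /m /Num.min; case: ltP => h.
    by rewrite subrr.
  exact: ler_norm.
Qed.

(** On a typed coupling the kernel splits into the two approximation errors and the difference of
    [w] at the two pairs of types. The latter is at most 2C and vanishes unless one of the two
    endpoints has mismatched types, whence the factor 4C. *)
Lemma delta_cut_typed (G H : wgraph R) (tau : node G -> T) (sigma : node H -> T)
    (w : T -> T -> R) (c d C : R) : (forall t t', `|w t t'| <= C) ->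
  cut_le (@normalized_nodew R G) (fun x y => edgew x y - w (tau x) (tau y)) c ->
  cut_le (@normalized_nodew R H) (fun x y => edgew x y - w (sigma x) (sigma y)) d ->
  delta_cut G H <= c + 4 * C * (\sum_t `|block_meas (@normalized_nodew R G) tau t -
    block_meas (@normalized_nodew R H) sigma t|) + d.
Proof.
move=> hw hc hd.
have [Z [Z0 ZG ZH hZ]] := typed_coupling tau sigma (@normalized_ge0 R G)
  (normalized_sum1 G) (@normalized_ge0 R H) (normalized_sum1 H).
have oZ : fractional_overlay Z by [].
apply: (delta_cut_le oZ).
have z0 := overlay_meas_ge0 oZ; have z1 := overlay_sum1 oZ.
have C0 : 0 <= C.
  have /card_gt0P[x _] := node_gt0 G.
  by apply: le_trans (hw (tau x) (tau x)).
set s := \sum_t `|_| in hZ *.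
pose mm (p : node G * node H) : R := (tau p.1 != sigma p.2)%:R.
have hmm : \sum_p overlay_meas Z p * mm p <= s.
  apply: le_trans hZ; rewrite pair_big/= le_eqVlt; apply/orP; left; apply/eqP.
  by apply: eq_bigr => -[].
have hmid : cut_le (overlay_meas Z)
    (fun p q => w (tau p.1) (tau q.1) - w (sigma p.2) (sigma q.2)) (4 * C * s).
  apply: cut_le_trans (cut_le_abs _ z0).
  apply: (@le_trans _ _ (\sum_p \sum_q overlay_meas Z p * overlay_meas Z q *
      (2 * C * (mm p + mm q)))).
    apply: ler_sum => p _; apply: ler_sum => q _; rewrite ler_wpM2l ?mulr_ge0//.
    rewrite /mm; case: eqP => [->|_]; case: eqP => [->|_] /=.
    - by rewrite subrr normr0 mulr_ge0// mulr_ge0.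
    - rewrite add0r mulr1; apply: le_trans (ler_normB _ _) _.
      by rewrite mulrDl mul1r lerD.
    - rewrite addr0 mulr1; apply: le_trans (ler_normB _ _) _.
      by rewrite mulrDl mul1r lerD.
    - apply: le_trans (ler_normB _ _) _; apply: (@le_trans _ _ (C + C)); first exact: lerD.
      by lra.
  have -> : \sum_p \sum_q overlay_meas Z p * overlay_meas Z q * (2 * C * (mm p + mm q)) =
     4 * C * \sum_p overlay_meas Z p * mm p; last first.
    by rewrite ler_wpM2l// mulr_ge0.
  have -> : \sum_p \sum_q overlay_meas Z p * overlay_meas Z q * (2 * C * (mm p + mm q)) =
      2 * C * (\sum_p overlay_meas Z p * mm p * \sum_q overlay_meas Z q) +
      2 * C * (\sum_p overlay_meas Z p * (\sum_q overlay_meas Z q * mm q)).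
    rewrite !mulr_sumr -big_split; apply: eq_bigr => p _ /=.
    rewrite !mulr_sumr -big_split; apply: eq_bigr => q _ /=; ring.
  by rewrite z1 -mulr_suml mulr1 -mulr_suml z1 mul1r; ring.
have hG := cut_le_pull z0 (overlay_fst oZ) hc.
have hH := cut_le_pull z0 (overlay_snd oZ) hd.
apply: eq_cut_le (cut_leB (cut_leD hG hmid) hH) => // p q.
by rewrite /overlay_ker /=; ring.
Qed.

End Coupling.

(** * Random samples of a weighted graph *)

Section SampledBlocks.
Context {R : realType} (V T : finType) (a : V -> R) (tau : V -> T) (k : nat).
Hypotheses (a_ge0 : forall x, 0 <= a x) (a_sum1 : \sum_x a x = 1).

(** Samples have [k.+1] nodes, so that they are never empty. *)
Definition unif (i : 'I_k.+1) : R := k.+1%:R^-1.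

Lemma unif_ge0 i : 0 <= unif i.
Proof. by rewrite invr_ge0 ler0n. Qed.

Lemma unif_sum1 : \sum_i unif i = 1.
Proof. by rewrite /unif sumr_const card_ord -[LHS]mulr_natr mulVf// pnatr_eq0. Qed.

(** The deviation is a mean of independent centred variables: the cross terms vanish and each
    diagonal term is at most the square of [k.+1%:R^-1]. *)
Lemma expect_block_var t :
  expect (fun _ : 'I_k.+1 => a) (fun phi =>
    (block_meas unif (fun i => tau (phi i)) t - block_meas a tau t) ^+ 2) <= k.+1%:R^-1.
Proof.
set mu := block_meas a tau t.
pose z x : R := (tau x == t)%:R - mu.
have mu0 : 0 <= mu by exact: block_meas_ge0.
have mu1 : mu <= 1.
  rewrite -a_sum1 /mu /block_meas [leLHS]big_mkcond; apply: ler_sum => x _.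
  by case: ifP => _.
have z_le x : `|z x| <= 1.
  by rewrite /z; case: (_ == _); rewrite /= ler_norml; apply/andP; split; lra.
have z_mean : \sum_x a x * z x = 0.
  under eq_bigr do rewrite mulrBr.
  rewrite sumrB -mulr_suml a_sum1 mul1r /mu /block_meas [X in _ - X]big_mkcond.
  apply/eqP; rewrite subr_eq0; apply/eqP; apply: eq_bigr => x _.
  by case: (_ == _); rewrite ?mulr1 ?mulr0.
have e (phi : {ffun 'I_k.+1 -> V}) :
    (block_meas unif (fun i => tau (phi i)) t - mu) ^+ 2 =
    \sum_i \sum_j unif i * unif j * (z (phi i) * z (phi j)).
  have -> : block_meas unif (fun i => tau (phi i)) t - mu = \sum_i unif i * z (phi i).
    rewrite -[mu]mul1r -unif_sum1 mulr_suml /block_meas big_mkcond -sumrB.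
    by apply: eq_bigr => i _; rewrite /z; case: (_ == _) => /=; ring.
  rewrite expr2 mulr_suml; apply: eq_bigr => i _; rewrite mulr_sumr.
  by apply: eq_bigr => j _; ring.
have -> : k.+1%:R^-1 = \sum_i unif i * unif i.
  by transitivity (k.+1%:R^-1 * \sum_i unif i); [rewrite unif_sum1 mulr1|rewrite mulr_sumr].
rewrite (eq_expect _ e) expect_sum; apply: ler_sum => i _.
rewrite expect_sum (bigD1 i)//= big1 ?addr0; last first.
  move=> j ji; rewrite expectZ.
  rewrite (@expect_indep _ _ _ _ (fun=> a_sum1) i z (fun phi => z (phi j))).
    by rewrite z_mean mul0r mulr0.
  by move=> phi x; rewrite updateN.
rewrite expectZ -[leRHS]mulr1 ler_wpM2l//.
  by rewrite mulr_ge0 ?unif_ge0.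
apply: expect_le_cst => // phi; apply: le_trans (ler_norm _) _.
by rewrite normrM -[leRHS]mul1r ler_pM.
Qed.

(** The bound y <= eta + y^2 / eta passes from the variance to the absolute deviation without a
    square root. *)
Lemma expect_block_dist (eta : R) : 0 < eta ->
  expect (fun _ : 'I_k.+1 => a) (fun phi =>
    \sum_t `|block_meas a tau t - block_meas unif (fun i => tau (phi i)) t|)
  <= #|T|%:R * (eta + k.+1%:R^-1 / eta).
Proof.
move=> e0; rewrite expect_sum mulr_natl -sumr_const; apply: ler_sum => t _.
apply: (@le_trans _ _ (expect (fun _ : 'I_k.+1 => a) (fun phi => eta + eta^-1 *
    (block_meas unif (fun i => tau (phi i)) t - block_meas a tau t) ^+ 2))).
  apply: le_expect => // phi; rewrite distrC; set x := _ - _.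
  rewrite -(@real_normK _ x) ?num_real//; set y := `|x|.
  have y0 : 0 <= y by exact: normr_ge0.
  rewrite mulrC; case: (leP y eta) => h.
    by apply: le_trans h _; rewrite lerDl divr_ge0 ?sqr_ge0// ltW.
  apply: (@le_trans _ _ (y ^+ 2 / eta)); last by rewrite lerDr ltW.
  by rewrite ler_pdivlMr// expr2 ler_wpM2l// ltW.
rewrite expectD expect_cst// expectZ lerD2l mulrC ler_wpM2r ?invr_ge0 ?(ltW e0)//.
exact: expect_block_var.
Qed.

End SampledBlocks.

Section FourDistinct.
Context {R : realType} (I V : finType) (a : V -> R).
Hypothesis a_sum1 : \sum_x a x = 1.

Lemma expect_cycle4 (U : V -> V -> R) (x y x' y' : I) : uniq [:: x; y; x'; y'] ->
  expect (fun _ : I => a) (fun phi => U (phi x) (phi y) * U (phi x') (phi y) *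
    U (phi x) (phi y') * U (phi x') (phi y')) = cycle4 a U.
Proof.
rewrite /= !inE !negb_or => /and4P[/and3P[xy xx' xy'] /andP[yx' yy'] x'y' _].
rewrite (expect_resample (fun=> a_sum1) _ y') (expect_resample (fun=> a_sum1) _ x').
rewrite (expect_resample (fun=> a_sum1) _ y) (expect_resample (fun=> a_sum1) _ x).
rewrite -[RHS](expect_cst (p := fun _ : I => a))//.
apply: eq_expect => phi; rewrite /cycle4; apply: eq_bigr => u _.
rewrite mulr_sumr; apply: eq_bigr => v _; rewrite !mulr_sumr; apply: eq_bigr => u' _.
rewrite !mulr_sumr; apply: eq_bigr => v' _.
rewrite !(ffunE, eqxx, negPf xy, negPf xx', negPf xy', negPf yx', negPf yy', negPf x'y').
by ring.
Qed.

End FourDistinct.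

Section RandomEdges.
Context {R : realType} (k : nat) (C : R).
Hypothesis C_gt0 : 0 < C.
Notation edge := ('I_k.+1 * 'I_k.+1)%type.

Definition signb (s : bool) : R := if s then 1 else -1.

Definition opair (i j : 'I_k.+1) : edge := if (i < j)%N then (i, j) else (j, i).

Lemma opairC i j : opair i j = opair j i.
Proof. by rewrite /opair; case: ltngtP => // /val_inj->. Qed.

Lemma opair_inj i j i' j' : opair i j = opair i' j' ->
  (i == i') && (j == j') || (i == j') && (j == i').
Proof. by rewrite /opair; do 2![case: ifP => _] => -[-> ->]; rewrite !eqxx ?orbT. Qed.

(* The weight of {i, j} is decided by the coin at its increasing orientation; the other
   coordinates of eps are idle. *)
Definition sample_edgew (eps : {ffun edge -> bool}) (i j : 'I_k.+1) : R :=
  if i == j then 0 else C * signb (eps (opair i j)).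

Lemma sample_edgew_sym eps i j : sample_edgew eps i j = sample_edgew eps j i.
Proof. by rewrite /sample_edgew eq_sym opairC. Qed.

Lemma sample_edgew_le eps i j : `|sample_edgew eps i j| <= C.
Proof.
rewrite /sample_edgew; case: eqP => _; first by rewrite normr0 ltW.
by rewrite normrM /signb; case: ifP => _; rewrite ?normrN normr1 mulr1 gtr0_norm.
Qed.

Lemma sample_edgew_update eps e s i j : opair i j != e ->
  sample_edgew (update eps e s) i j = sample_edgew eps i j.
Proof. by move=> h; rewrite /sample_edgew updateN. Qed.

Definition sample_graph (eps : {ffun edge -> bool}) : wgraph R.
Proof.
refine (@WGraph R 'I_k.+1 (fun _ _ => true) (fun=> 1) (sample_edgew eps) _ _ _ _ _).
- by rewrite card_ord.
- by [].
- by move=> _; exact: ltr01.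
- exact: sample_edgew_sym.
- by [].
Defined.

Lemma sample_graph_nodew eps :
  @normalized_nodew R (sample_graph eps) =1 unif (k := k).
Proof.
by move=> i; rewrite /normalized_nodew /total_nodew /= sumr_const card_ord div1r.
Qed.

Variables (V : finType) (b : V -> V -> R).
Hypotheses (b_sym : forall x y, b x y = b y x) (b_le : forall x y, `|b x y| <= C).

(* The law of the coin at e, for which C * signb has mean b (X e.1) (X e.2); idle coins
   are fair. *)
Definition edge_law (X : 'I_k.+1 -> V) (e : edge) (s : bool) : R :=
  2^-1 + (if (e.1 < e.2)%N then signb s / (2 * C) else 0) * b (X e.1) (X e.2).

Lemma edge_law_ge0 X e s : 0 <= edge_law X e s.
Proof.
rewrite /edge_law; case: ifP => _; last by rewrite mul0r addr0 invr_ge0 ler0n.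
have := b_le (X e.1) (X e.2); rewrite ler_norml => /andP[h1 h2].
have -> : 2^-1 + signb s / (2 * C) * b (X e.1) (X e.2) =
    (C + signb s * b (X e.1) (X e.2)) / (2 * C).
  by field; rewrite gt_eqF.
apply: divr_ge0; last by rewrite mulr_ge0// ltW.
by rewrite /signb; case: s; lra.
Qed.

Lemma edge_law_sum1 X e : \sum_s edge_law X e s = 1.
Proof.
by rewrite big_bool /edge_law /signb /=; case: ifP => _; field; rewrite ?gt_eqF.
Qed.

Lemma edge_law_mean X i j w : i != j ->
  \sum_s edge_law X (opair i j) s * (C * signb s - w) = b (X i) (X j) - w.
Proof.
move=> ij; have C0 : C != 0 by rewrite gt_eqF.
rewrite big_bool /edge_law /opair /signb /=; case: (ltngtP i j) => h /=.
- by rewrite h; field.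
- by rewrite h b_sym; field.
- by rewrite (val_inj h) eqxx in ij.
Qed.

Lemma expect_edge X i j w H : i != j ->
  (forall eps s, H (update eps (opair i j) s) = H eps) ->
  expect (edge_law X) (fun eps => (sample_edgew eps i j - w) * H eps) =
  (b (X i) (X j) - w) * expect (edge_law X) H.
Proof.
move=> ij hH; rewrite -(edge_law_mean X w ij) -(expect_indep (edge_law_sum1 X) _ hH).
by apply: eq_expect => eps; rewrite /sample_edgew (negPf ij).
Qed.

(** Since the nodes are distinct, the four edges of the cycle use four different coins; given [X]
    each factor can be replaced by its mean. *)
Lemma expect_edges4 X (W : V -> V -> R) (x y x' y' : 'I_k.+1) :
  uniq [:: x; y; x'; y'] ->
  let D eps i j := sample_edgew eps i j - W (X i) (X j) in
  let U i j := b (X i) (X j) - W (X i) (X j) in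
  expect (edge_law X) (fun eps => D eps x y * D eps x' y * D eps x y' * D eps x' y') =
  U x y * U x' y * U x y' * U x' y'.
Proof.
rewrite /= !inE !negb_or => /and4P[/and3P[xy xx' xy'] /andP[yx' yy'] x'y' _].
have ne i j i' j' : ~~ ((i == i') && (j == j') || (i == j') && (j == i')) ->
    opair i j != opair i' j' by apply: contraNneq => /opair_inj.
have x'y : x' != y by rewrite eq_sym.
have nn := (negPf xy, negPf xx', negPf xy', negPf yx', negPf yy', negPf x'y',
  eq_sym x' x, eq_sym x' y, eq_sym y' x, eq_sym y' y, eq_sym y' x', eq_sym y x).
pose d i j eps := sample_edgew eps i j - W (X i) (X j).
transitivity (expect (edge_law X)
    (fun eps => d x y eps * (d x' y eps * (d x y' eps * (d x' y' eps * 1))))).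
  by apply: eq_expect => eps; rewrite /d; ring.
have step i j (H : {ffun edge -> bool} -> R) : i != j ->
    (forall eps s, H (update eps (opair i j) s) = H eps) ->
    expect (edge_law X) (fun eps => d i j eps * H eps) =
    (b (X i) (X j) - W (X i) (X j)) * expect (edge_law X) H by apply: expect_edge.
have dU i j i' j' eps s : opair i j != opair i' j' ->
    d i j (update eps (opair i' j') s) = d i j eps.
  by move=> h; rewrite /d sample_edgew_update.
rewrite step// => [|eps s]; last by rewrite !dU// ne ?nn ?andbF.
rewrite step// => [|eps s]; last by rewrite !dU// ne ?nn ?andbF.
rewrite step// => [|eps s]; last by rewrite !dU// ne ?nn ?andbF.
rewrite step// expect_cst; last exact: edge_law_sum1.
by ring.
Qed.

End RandomEdges.

Section SampleDistance.
Context {R : realType} (k : nat) (C : R).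
Hypothesis C_gt0 : 0 < C.
Notation edge := ('I_k.+1 * 'I_k.+1)%type.

(** A uniform index hits each entry of [s] with probability 1 / (k + 1). In use, [s] lists the
    indices chosen earlier and the inner sum counts collisions with them. *)
Lemma mean_diag (s : seq 'I_k.+1) (A B : R) :
  \sum_j @unif R k j * (A + B * \sum_(p <- s) (p == j)%:R) =
  A + B * (size s)%:R / k.+1%:R.
Proof.
under eq_bigr do rewrite mulrDr; rewrite big_split/= -mulr_suml unif_sum1 mul1r.
congr (_ + _); elim: s => [|p s IH].
  by rewrite big1 ?mulr0 ?mul0r// => j _; rewrite big_nil !mulr0.
under eq_bigr do rewrite big_cons !mulrDr; rewrite big_split/= IH.
rewrite (bigD1 p)//= eqxx big1 => [|j jp]; last by rewrite eq_sym (negPf jp) !mulr0.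
by rewrite /unif /= -[(size s).+1]addn1 natrD; ring.
Qed.

Section Kernel.
Variables (V : finType) (a : V -> R) (b W : V -> V -> R).
Hypotheses (a_ge0 : forall x, 0 <= a x) (a_sum1 : \sum_x a x = 1).
Hypotheses (b_sym : forall x y, b x y = b y x) (b_le : forall x y, `|b x y| <= C).
Hypothesis W_le : forall x y, `|W x y| <= C.

Definition sample_expect (H : ('I_k.+1 -> V) -> {ffun edge -> bool} -> R) : R :=
  expect (fun _ : 'I_k.+1 => a) (fun X => expect (edge_law C b X) (H X)).

Lemma le_sample_expect H H' : (forall X eps, H X eps <= H' X eps) ->
  sample_expect H <= sample_expect H'.
Proof.
move=> h; apply: le_expect => // X; apply: le_expect => // e s.
exact: edge_law_ge0.
Qed.

Lemma sample_expect_cst c : sample_expect (fun _ _ => c) = c.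
Proof.
rewrite /sample_expect -[RHS](expect_cst (p := fun _ : 'I_k.+1 => a))//.
by apply: eq_expect => X; rewrite expect_cst// => e; exact: edge_law_sum1.
Qed.

Lemma sample_expectD H H' :
  sample_expect (fun X eps => H X eps + H' X eps) = sample_expect H + sample_expect H'.
Proof. by rewrite -expectD; apply: eq_expect => X; rewrite expectD. Qed.

Lemma sample_expectZ c H :
  sample_expect (fun X eps => c * H X eps) = c * sample_expect H.
Proof. by rewrite -expectZ; apply: eq_expect => X; rewrite expectZ. Qed.

Lemma sample_expect_sum (J : finType) (H : J -> ('I_k.+1 -> V) -> {ffun edge -> bool} -> R) :
  sample_expect (fun X eps => \sum_j H j X eps) = \sum_j sample_expect (H j).
Proof. by rewrite -expect_sum; apply: eq_expect => X; rewrite expect_sum. Qed.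

Definition sample_diff (X : 'I_k.+1 -> V) (eps : {ffun edge -> bool}) i j : R :=
  sample_edgew C eps i j - W (X i) (X j).

Lemma sample_diff_le X eps i j : `|sample_diff X eps i j| <= 2 * C.
Proof.
rewrite mulrDl mul1r; apply: le_trans (ler_normB _ _) _.
by apply: lerD => //; exact: sample_edgew_le.
Qed.

(* Quadruples with a repetition have proportion at most 6 / k.+1. *)
Lemma sample_expect_cycle4 :
  sample_expect (fun X eps => cycle4 (@unif R k) (sample_diff X eps)) <=
  cycle4 a (fun x y => b x y - W x y) + 6 * (2 * C) ^+ 4 / k.+1%:R.
Proof.
set c4 := cycle4 a _; set M4 := (2 * C) ^+ 4.
have c40 : 0 <= c4 by apply: cycle4_ge0.
have M40 : 0 <= M4 by rewrite exprn_ge0// mulr_ge0// ltW.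
pose P X eps x y x' y' := sample_diff X eps x y * sample_diff X eps x' y *
  sample_diff X eps x y' * sample_diff X eps x' y'.
(* One copy of [M4] for each possible coincidence of an index with an earlier one: 1 + 2 + 3 = 6 in
   total. *)
pose F x y x' (y' : 'I_k.+1) := c4 + M4 * (\sum_(p <- [:: x]) (p == y)%:R)
  + M4 * (\sum_(p <- [:: x; y]) (p == x')%:R) + M4 * (\sum_(p <- [:: x; y; x']) (p == y')%:R).
have hF x y x' y' : sample_expect (fun X eps => P X eps x y x' y') <= F x y x' y'.
  rewrite /F !big_cons !big_nil; case: (boolP (uniq [:: x; y; x'; y'])) => [hu|].
    have -> : sample_expect (fun X eps => P X eps x y x' y') = c4.
      rewrite /c4 -(expect_cycle4 a_sum1 _ hu); apply: eq_expect => X.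
      exact: (expect_edges4 C_gt0 b_sym X W hu).
    by rewrite -!addrA lerDl !addr_ge0// mulr_ge0// !addr_ge0.
  move=> hu; apply: (@le_trans _ _ M4).
    rewrite -[leRHS]sample_expect_cst; apply: le_sample_expect => X eps.
    apply: le_trans (ler_norm _) _; rewrite /P !normrM /M4.
    have h i j := sample_diff_le X eps i j.
    by rewrite !exprSr expr0 mul1r !ler_pM// !mulr_ge0.
  move: hu; rewrite /= !inE; case: (x == y); case: (x == x'); case: (x == y');
    case: (y == x'); case: (y == y'); case: (x' == y') => //= _; lra.
set u := k.+1%:R^-1.
have e1 x y x' : \sum_y' unif y' * F x y x' y' = c4 + M4 * 3 * u
    + M4 * (\sum_(p <- [:: x]) (p == y)%:R) + M4 * (\sum_(p <- [:: x; y]) (p == x')%:R).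
  by rewrite mean_diag -/u /=; ring.
have e2 x y : \sum_x' unif x' * (\sum_y' unif y' * F x y x' y') =
    c4 + M4 * 5 * u + M4 * (\sum_(p <- [:: x]) (p == y)%:R).
  by under eq_bigr do rewrite e1; rewrite mean_diag -/u /=; ring.
have e3 x : \sum_y unif y * (\sum_x' unif x' * (\sum_y' unif y' * F x y x' y')) =
    c4 + M4 * 6 * u.
  by under eq_bigr do rewrite e2; rewrite mean_diag -/u /=; ring.
have -> : c4 + 6 * M4 * u =
    \sum_x unif x * (\sum_y unif y * (\sum_x' unif x' * (\sum_y' unif y' * F x y x' y'))).
  under eq_bigr do rewrite e3.
  by rewrite -mulr_suml unif_sum1; ring.
rewrite /cycle4 sample_expect_sum; apply: ler_sum => x _.
rewrite sample_expect_sum mulr_sumr; apply: ler_sum => y _.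
rewrite sample_expect_sum !mulr_sumr; apply: ler_sum => x' _.
rewrite sample_expect_sum !mulr_sumr; apply: ler_sum => y' _.
rewrite sample_expectZ !mulrA; apply: ler_wpM2l; last exact: hF.
by rewrite !mulr_ge0 ?unif_ge0.
Qed.

End Kernel.
End SampleDistance.

(** * Laws of random samples and the Cauchy property *)

Section RandomGraph.
Context {R : realType} (C : R).
Hypothesis C_gt0 : 0 < C.

Definition edgew_le (G : wgraph R) := forall i j : node G, `|edgew i j| <= C.

(** A bound for each single outcome: sampled node [i] inherits the type of [X i], and the distance
    of the sample from the same step kernel is controlled by a four-cycle density. *)
Lemma delta_cut_sample (k : nat) (G : wgraph R) (T : finType) (tau : node G -> T)
    (w : T -> T -> R) (c eta : R) (X : 'I_k.+1 -> node G)
    (eps : {ffun 'I_k.+1 * 'I_k.+1 -> bool}) :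
  0 < eta -> (forall t t', `|w t t'| <= C) ->
  cut_le (@normalized_nodew R G) (fun x y => edgew x y - w (tau x) (tau y)) c ->
  delta_cut G (sample_graph C eps) <=
    c + 4 * C * (\sum_t `|block_meas (@normalized_nodew R G) tau t -
       block_meas (@unif R k) (fun i => tau (X i)) t|) +
    (eta + cycle4 (@unif R k)
       (sample_diff C (fun x y => w (tau x) (tau y)) X eps) / eta ^+ 3).
Proof.
move=> eta0 hw hc.
have hd := cut_le_cycle4 (@unif_ge0 R k) (unif_sum1 k)
  (sample_diff C (fun x y => w (tau x) (tau y)) X eps) eta0.
have := delta_cut_typed (H := sample_graph C eps) (sigma := fun i : 'I_k.+1 => tau (X i))
  hw hc (eq_cut_le (fun i => esym (@sample_graph_nodew R k C eps i)) (fun _ _ => erefl) hd).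
under [X in _ <= _ + _ * X + _ -> _]eq_bigr => t _.
  rewrite (_ : block_meas (@normalized_nodew R (sample_graph C eps)) _ t =
    block_meas (@unif R k) (fun i => tau (X i)) t); last first.
    by apply: eq_bigr => i _; exact: sample_graph_nodew.
  over.
by [].
Qed.

(** Here [e] is the regularity error, [eta] the threshold in the four-cycle bound and [eta'] the one
    in the block-weight bound. The powers of 2C come from differences of two kernels bounded by
    C. *)
Lemma sample_expect_delta_cut (k K : nat) (G : wgraph R) (e eta eta' : R) :
  edgew_le G -> 0 < e -> C ^+ 2 < K%:R * e ^+ 2 -> 0 < eta -> 0 < eta' ->
  sample_expect C (@normalized_nodew R G) (@edgew R G)
    (fun (_ : 'I_k.+1 -> node G) eps => delta_cut G (sample_graph C eps)) <=
  (e + e) + 4 * C * (#|split_type K|%:R * (eta' + k.+1%:R^-1 / eta')) +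
    (eta + (4 * (e + e) * (2 * C) ^+ 3 + 6 * (2 * C) ^+ 4 / k.+1%:R) / eta ^+ 3).
Proof.
move=> hG e0 hK eta0 eta0'.
have a0 := @normalized_ge0 R G; have a1 := normalized_sum1 G.
have [tau [w [hw hc]]] := weak_regularity a0 a1 hG e0 hK (ltW C_gt0).
have bs := @edgew_sym R G.
pose D (X : 'I_k.+1 -> node G) := sample_diff C (fun x y => w (tau x) (tau y)) X.
pose S (X : 'I_k.+1 -> node G) := \sum_t `|block_meas (@normalized_nodew R G) tau t -
       block_meas (@unif R k) (fun i => tau (X i)) t|.
apply: (@le_trans _ _ (sample_expect C (@normalized_nodew R G) (@edgew R G)
    (fun X eps => (e + e) + 4 * C * S X +
       (eta + (eta ^+ 3)^-1 * cycle4 (@unif R k) (D X eps))))).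
  apply: le_sample_expect => // X eps; rewrite [_^-1 * _]mulrC.
  exact: delta_cut_sample.
rewrite !(sample_expectD, sample_expectZ, sample_expect_cst k C_gt0 _ a1).
have hS : sample_expect C (@normalized_nodew R G) (@edgew R G) (fun X _ => S X) <=
    #|split_type K|%:R * (eta' + k.+1%:R^-1 / eta').
  rewrite /sample_expect; under eq_expect => X.
    rewrite expect_cst; last exact: edge_law_sum1.
    over.
  exact: expect_block_dist.
have hD : sample_expect C (@normalized_nodew R G) (@edgew R G)
    (fun X eps => cycle4 (@unif R k) (D X eps)) <=
    4 * (e + e) * (2 * C) ^+ 3 + 6 * (2 * C) ^+ 4 / k.+1%:R.
  apply: le_trans (sample_expect_cycle4 k C_gt0 a0 a1 bs hG _) _ => [x y|]; first exact: hw.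
  rewrite lerD2r; apply: cycle4_le_cut => //; first by rewrite mulr_gt0.
  move=> x y; rewrite mulrDl mul1r; apply: le_trans (ler_normB _ _) _.
  by apply: lerD; [exact: hG|exact: hw].
apply: lerD; first by rewrite lerD2l ler_wpM2l// mulr_ge0// ltW.
by rewrite lerD2l mulrC ler_wpM2r// invr_ge0 exprn_ge0// ltW.
Qed.

Definition sample_prob (k : nat) (G : wgraph R) (eps : {ffun 'I_k.+1 * 'I_k.+1 -> bool}) : R :=
  expect (fun _ : 'I_k.+1 => @normalized_nodew R G)
    (fun X => \prod_e edge_law C (@edgew R G) X e (eps e)).

Lemma sum_sample_prob (k : nat) (G : wgraph R) h :
  \sum_eps @sample_prob k G eps * h eps =
  sample_expect C (@normalized_nodew R G) (@edgew R G) (fun _ => h).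
Proof.
rewrite /sample_expect /sample_prob /expect.
under eq_bigr do rewrite mulr_suml.
rewrite exchange_big; apply: eq_bigr => X _ /=.
by rewrite mulr_sumr; apply: eq_bigr => eps _; rewrite mulrA.
Qed.

Lemma sample_prob_ge0 (k : nat) (G : wgraph R) eps : edgew_le G -> 0 <= @sample_prob k G eps.
Proof.
move=> hG; rewrite -[leLHS](expect_cst (p := fun _ : 'I_k.+1 => @normalized_nodew R G)).
  apply: le_expect => [i x|X]; first exact: normalized_ge0.
  by apply: prodr_ge0 => e _; exact: edge_law_ge0.
by move=> _; exact: normalized_sum1.
Qed.

Lemma sample_prob_sum1 (k : nat) (G : wgraph R) : \sum_eps @sample_prob k G eps = 1.
Proof.
under eq_bigr do rewrite -[sample_prob _]mulr1.
by rewrite sum_sample_prob sample_expect_cst//; exact: normalized_sum1.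
Qed.

Lemma sample_close (zeta : R) : 0 < zeta -> exists k : nat, forall G : wgraph R, edgew_le G ->
  \sum_eps @sample_prob k G eps * delta_cut G (sample_graph C eps) <= zeta.
Proof.
(* The final bound is [B * e + N * eta' + L * u + eta], with each term at most [eta]. The parameters
   [eta], [e], [K], [eta'], [k] are chosen in this order from [zeta] and [C] alone, hence uniformly
   in [G]. *)
move=> z0; pose eta := zeta / 8; have eta0 : 0 < eta by rewrite divr_gt0.
pose B := 4 * 2 * (2 * C) ^+ 3 / eta ^+ 3 + 2.
have C2 : 0 < 2 * C by rewrite mulr_gt0.
have B0 : 0 < B by rewrite ltr_wpDl// divr_ge0 ?exprn_ge0// ?mulr_ge0 ?exprn_ge0// ltW.
pose e := eta / B; have e0 : 0 < e by rewrite divr_gt0.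
pose K := Num.bound (C ^+ 2 / e ^+ 2).
have hK : C ^+ 2 < K%:R * e ^+ 2.
  rewrite -ltr_pdivrMr ?exprn_gt0//; apply: archi_boundP.
  by rewrite divr_ge0 ?exprn_ge0// ltW.
pose N : R := 4 * C * #|split_type K|%:R.
have N0 : 0 <= N by rewrite mulr_ge0// mulr_ge0// ltW.
pose eta' := eta / (N + 1); have eta0' : 0 < eta' by rewrite divr_gt0// ltr_wpDl.
pose L := N / eta' + 6 * (2 * C) ^+ 4 / eta ^+ 3.
have L0 : 0 <= L.
  apply: addr_ge0; apply: divr_ge0 => //; [exact: ltW| |exact/exprn_ge0/ltW].
  by rewrite mulr_ge0// exprn_ge0// ltW.
pose k := Num.bound (L / eta); exists k => G hG; rewrite sum_sample_prob.
apply: le_trans (sample_expect_delta_cut k hG e0 hK eta0 eta0') _.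
set u := k.+1%:R^-1.
have hu : L * u <= eta.
  rewrite ler_pdivrMr ?ltr0n// -ler_pdivrMl// mulrC ltW//.
  apply: (@lt_trans _ _ k%:R); last by rewrite ltr_nat.
  by apply: archi_boundP; rewrite divr_ge0// ltW.
have hN : N * eta' <= eta.
  by rewrite mulrCA ger_pMr// ler_pdivrMr ?mul1r ?ltr_wpDl// lerDl.
have he : B * e = eta by rewrite mulrC divfK// gt_eqF.
have -> : e + e + 4 * C * (#|split_type K|%:R * (eta' + u / eta')) +
    (eta + (4 * (e + e) * (2 * C) ^+ 3 + 6 * (2 * C) ^+ 4 * u) / eta ^+ 3) =
    B * e + N * eta' + L * u + eta.
  by rewrite /B /L /N; ring.
by rewrite he; have : eta * 8 = zeta by [rewrite divfK|]; lra.
Qed.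

Lemma delta_cut_ge0 (G H : wgraph R) : 0 <= delta_cut G H.
Proof.
rewrite leNgt; apply/negP => h.
have [X _ /cut_le_ge0 hX] : exists2 X : node G -> node H -> R, fractional_overlay X &
    cut_le (overlay_meas X) (@overlay_ker R G H) (delta_cut G H / 2).
  by apply: delta_cut_lt; lra.
lra.
Qed.

(** [A] arises from expanding a product over all ordered pairs. Only its increasing pairs become
    edges; a set with any other pair has coefficient 0 in [sample_probE]. *)
Definition set_adj (k : nat) (A : {set 'I_k * 'I_k}) (i j : 'I_k) :=
  ((i, j) \in A) && (i < j)%N || ((j, i) \in A) && (j < i)%N.

Definition set_graph (k : nat) (A : {set 'I_k * 'I_k}) : sgraph.
Proof.
refine (@SGraph k (set_adj A) _ _).
- by move=> i j; rewrite /set_adj orbC.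
- by move=> i; rewrite /set_adj ltnn !andbF.
Defined.

(** Each factor of the law is a constant plus a multiple of an edgeweight. In the expanded product,
    [A] is the set of pairs contributing the edgeweight, and the coefficients do not depend on
    [G]. *)
Lemma sample_probE (k : nat) (G : wgraph R) eps : @sample_prob k G eps =
  \sum_(A : {set 'I_k.+1 * 'I_k.+1})
    (\prod_e if e \in A then
       (if (e.1 < e.2)%N then signb (eps e) / (2 * C) else 0) else 2^-1) *
    hom_density (set_graph A) G.
Proof.
rewrite /sample_prob.
have e1 (X : {ffun 'I_k.+1 -> node G}) : \prod_e edge_law C (@edgew R G) X e (eps e) =
  \sum_(A : {set 'I_k.+1 * 'I_k.+1})
    (\prod_e if e \in A then
       (if (e.1 < e.2)%N then signb (eps e) / (2 * C) else 0) else 2^-1) *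
    \prod_(e in A) edgew (X e.1) (X e.2).
  rewrite /edge_law; under eq_bigr do rewrite addrC.
  rewrite bigA_distr; apply: eq_bigr => A _.
  rewrite [X in _ = _ * X]big_mkcond -big_split; apply: eq_bigr => e _ /=.
  by case: ifP => _; rewrite ?mulr1.
rewrite (eq_expect _ e1) expect_sum; apply: eq_bigr => A _; rewrite expectZ.
case: (boolP [forall e in A, (e.1 < e.2)%N]) => [/forall_inP hA|].
  congr (_ * _); rewrite hom_densityE /=; apply: eq_expect => X.
  rewrite /sedges big_filter; apply: eq_bigl => e /=.
  rewrite /set_adj -surjective_pairing; case: (boolP (e \in A)) => eA /=.
    by rewrite (hA _ eA).
  by case: ltngtP => //; rewrite ?andbF.
rewrite negb_forall_in => /exists_inP[e eA he].
by rewrite (bigD1 e)//= eA (negPf he) !mul0r.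
Qed.

Lemma sample_prob_cvg (k : nat) (G : nat -> wgraph R) eps : left_convergent G ->
  cvg (@sample_prob k (G n) eps @[n --> \oo])%classic.
Proof.
move=> hG; under eq_fun do rewrite sample_probE.
apply/cvg_ex; eexists; apply: cvg_big => [|A _]; first exact: add_continuous.
apply: cvgMr; exact: (hG (set_graph A)).
Qed.

(** The triangle inequality through a common sample is averaged over the law of the sample of [G m].
    Replacing this law by that of [G n] in the second distance costs at most 2C times the l1
    distance of the laws, estimated through their limit [l]. *)
Lemma left_convergent_cut_cauchy (G : nat -> wgraph R) :
  (forall n, edgew_le (G n)) -> left_convergent G -> cut_cauchy G.
Proof.
move=> hG hcvg zeta z0.
(* Two sampling errors of zeta / 4 and two changes of law of zeta / 8 add up to less than [zeta]. *)
have [k hk] := @sample_close (zeta / 4) ltac:(lra).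
pose l eps := lim (@sample_prob k (G n) eps @[n --> \oo])%classic.
pose S n := \sum_eps `|sample_prob (G n) eps - l eps|.
have hS : (S n @[n --> \oo] --> (0 : R))%classic.
  suff : (S n @[n --> \oo] -->
      \sum_(eps : {ffun 'I_k.+1 * 'I_k.+1 -> bool}) (0 : R))%classic by rewrite big1.
  apply: cvg_big => [|eps _]; first exact: add_continuous.
  rewrite -(@normr0 _ R) -(subrr (l eps)); apply: cvg_norm; apply: cvgB; last exact: cvg_cst.
  exact: sample_prob_cvg.
have d0 : 0 < zeta / (16 * C) by rewrite divr_gt0// mulr_gt0.
move/cvgrPdist_lt: hS => /(_ _ d0)[N _ hN].
exists N => m n Nm Nn.
have hSn p : (N <= p)%N -> S p * (2 * C) < zeta / 8.
  move=> /hN /=; rewrite sub0r normrN => h.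
  have : S p < zeta / (16 * C) by apply: le_lt_trans h; exact: ler_norm.
  rewrite -(ltr_pM2r (_ : 0 < 2 * C)) ?mulr_gt0//; congr (_ < _).
  by field; rewrite gt_eqF.
pose d p eps := delta_cut (G p) (sample_graph C (k := k) eps).
have d_le p eps : 0 <= d p eps <= 2 * C.
  rewrite delta_cut_ge0 delta_cut_bounded//; first exact: hG.
  by move=> i j; exact: sample_edgew_le.
have -> : delta_cut (G m) (G n) = \sum_eps @sample_prob k (G m) eps * delta_cut (G m) (G n).
  by rewrite -mulr_suml sample_prob_sum1 mul1r.
apply: (@le_lt_trans _ _ (\sum_eps (sample_prob (G m) eps * d m eps +
    sample_prob (G n) eps * d n eps + (`|sample_prob (G m) eps - l eps| * (2 * C) +
    `|sample_prob (G n) eps - l eps| * (2 * C))))).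
  apply: ler_sum => eps _.
  apply: (@le_trans _ _ (sample_prob (G m) eps * (d m eps + d n eps))).
    by rewrite ler_wpM2l ?sample_prob_ge0// delta_cut_triangle.
  rewrite mulrDr -addrA lerD2l -lerBlDl -mulrBl -mulrDl.
  have /andP[dn0 dnC] := d_le n eps.
  apply: (@le_trans _ _ (`|sample_prob (G m) eps - sample_prob (G n) eps| * d n eps)).
    by rewrite ler_wpM2r// ler_norm.
  apply: ler_pM => //; rewrite -(subrKA (l eps)); apply: le_trans (ler_normD _ _) _.
  by rewrite lerD2l distrC.
rewrite !big_split/= -!mulr_suml -/(S m) -/(S n).
have := hk _ (hG m); have := hk _ (hG n); have := hSn _ Nm; have := hSn _ Nn.
by rewrite /d; lra.
Qed.

End RandomGraph.

Theorem theorem2p6 (R : realType) (G : nat -> wgraph R)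
    (hG : bounded_edgew G) :
  left_convergent G <-> cut_cauchy G.
Proof.
split; last exact: cut_cauchy_left_convergent.
(* The coin weights C and -C require a positive bound, hence the maximum with 1. *)
have [C hC] := hG; apply: (@left_convergent_cut_cauchy R (Num.max C 1)).
  by rewrite lt_max ltr01 orbT.
by move=> n i j; rewrite le_max hC.
Qed.
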